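(* For any $a,b\in\mathbb C$, there is a Lie algebra homomorphism $\mathfrak t_{\mathrm{ell}}^\Phi\to H_{\hbar,c}$ defined by $$x(v)\mapsto a\,\pi(v),\qquad y(u)\mapsto b\,u,\qquad t_\gamma\mapsto ab\left(\frac{\hbar}{h^\vee}-\frac{2c_{s_\gamma}}{(\gamma|\gamma)}s_\gamma\right)$$ for $u,v\in\mathfrak h$ and $\gamma\in\Phi^+$.
   Context: $\Phi$ is an irreducible finite reduced crystallographic root system with Weyl group $W$, positive roots $\Phi^+$, and complexified reflection representation $\mathfrak h$ (so $\Phi\subset\mathfrak h^*$). A root subsystem is a subset $\Psi\subset\Phi$ with $\mathbb Z\Psi\cap\Phi=\Psi$; $\Psi^+=\Psi\cap\Phi^+$. $\mathfrak t_{\mathrm{ell}}^\Phi$ is the Lie algebra generated by $t_\alpha$ ($\alpha\in\Phi$, $t_{-\alpha}=t_\alpha$) and linear maps $x,y:\mathfrak h\to\mathfrak t_{\mathrm{ell}}^\Phi$, with relations: $[t_\alpha,\sum_{\beta\in\Psi^+}t_\beta]=0$ for every rank 2 root subsystem $\Psi$ and $\alpha\in\Psi$; $[x(u),x(v)]=0=[y(u),y(v)]$; $[y(u),x(v)]=\sum_{\gamma\in\Phi^+}\langle v,\gamma\rangle\langle u,\gamma\rangle t_\gamma$; $[t_\alpha,x(u)]=0=[t_\alpha,y(u)]$ if $\alpha(u)=0$. Rational Cherednik algebra: $S\subset W$ is the set of reflections; for $s\in S$, $\alpha_s$ is the positive root with $s=s_{\alpha_s}$ and $\alpha_s^\vee\in\mathfrak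 h$ its coroot. $K$ is the space of $W$-invariant functions $S\to\mathbb C$, $\widetilde K=K\oplus\mathbb C$, with standard linear functions $c_s$ ($s\in S$, $c_s$ depending only on the conjugacy class) and $\hbar$. $H_{\hbar,c}$ is the quotient of $(\mathbb CW\ltimes T(\mathfrak h\oplus\mathfrak h^* ))[\widetilde K]$ (with $\mathbb C[\widetilde K]$ central) by the relations $[x,x']=0$, $[y,y']=0$, $[y,x]=\hbar\langle y,x\rangle-\sum_{s\in S}c_s\langle\alpha_s,y\rangle\langle\alpha_s^\vee,x\rangle s$ for $x,x'\in\mathfrak h^*$, $y,y'\in\mathfrak h$. $h^\vee=1+\sum_ig_i$ is the dual Coxeter number, where $\tilde\alpha$ is the highest root and $\tilde\alpha^\vee=\sum_ig_i\alpha_i^\vee$ in terms of simple coroots. $(\cdot|\cdot)$ is the non-degenerate $W$-invariant symmetric bilinear form on $\mathfrak h$ normalized so that $(\tilde\alpha^\vee|\tilde\alpha^\vee)=2$; $\pi:\mathfrak h\to\mathfrak h^*$ is the isomorphism it induces, and $(\cdot|\cdot)$ also denotes the induced form on $\mathfrak h^*$. $s_\gamma$ is the reflection of the root $\gamma$. *)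

(* Defs.v *)
From HB Require Import structures.
From mathcomp Require Import all_boot all_order all_algebra.
From mathcomp Require Import finmap.
From mathcomp Require Import boolp reals.
From mathcomp Require Import complex.

Set Implicit Arguments.
Unset Strict Implicit.
Unset Printing Implicit Defensive.

Import Order.TTheory GRing.Theory Num.Theory.

Local Open Scope ring_scope.
Local Open Scope quotient_scope.

HB.mixin Record Lmodule_isLie (K : pzRingType) L of GRing.Lmodule K L := {
  bracket : L -> L -> L;
  bracket_linearl : forall (a : K) (u v w : L),
    bracket (a *: u + v) w = a *: bracket u w + bracket v w;
  bracket_linearr : forall (a : K) (u v w : L),
    bracket w (a *: u + v) = a *: bracket w u + bracket w v;
  bracketvv : forall u : L, bracket u u = 0;
  jacobi : forall u v w : L,
    bracket u (bracket v w) + bracket v (bracket w u)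
      + bracket w (bracket u v) = 0
}.

#[short(type="lieAlgType")]
HB.structure Definition LieAlgebra (K : pzRingType) :=
  {L of GRing.Lmodule K L & Lmodule_isLie K L}.

Definition lie_hom (K : pzRingType) (L M : lieAlgType K) (f : L -> M) : Prop :=
  linear f /\ {morph f : u v / bracket u v}.

Section CommutatorLie.
Context (K : comPzRingType) (A : algType K).
Implicit Types u v w : A.

Definition commutator u v : A := u * v - v * u.

Lemma commutator_linearl (a : K) u v w :
  commutator (a *: u + v) w = a *: commutator u w + commutator v w.
Proof.
rewrite /commutator mulrDl mulrDr -scalerAl -scalerAr scalerBr opprD.
by rewrite addrACA.
Qed.

Lemma commutator_linearr (a : K) u v w :
  commutator w (a *: u + v) = a *: commutator w u + commutator w v.
Proof.
rewrite /commutator mulrDl mulrDr -scalerAl -scalerAr scalerBr opprD.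
by rewrite addrACA.
Qed.

Lemma commutatorvv u : commutator u u = 0.
Proof. exact: subrr. Qed.

Lemma commutator_jacobi u v w :
  commutator u (commutator v w) + commutator v (commutator w u)
    + commutator w (commutator u v) = 0.
Proof.
rewrite /commutator !mulrBr !mulrBl !mulrA !opprB.
set a := u * v * w; set b := u * w * v; set c := v * w * u.
set d := w * v * u; set e := v * u * w; set g := w * u * v.
rewrite (AC ((2*2)*(2*2)*(2*2)) ((1*12)*(7*2)*(3*10)*(5*4)*(11*6)*(9*8))) /=.
by rewrite !subrr !addr0.
Qed.

Definition commutator_lie_mixin :=
  Lmodule_isLie.Build K A commutator_linearl commutator_linearr
    commutatorvv commutator_jacobi.

End CommutatorLie.

Section PresentedLie.
Context (K : comPzRingType) (X : Type).

Inductive lie_term : Type :=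
| LGen of X
| LZero
| LAdd of lie_term & lie_term
| LScale of K & lie_term
| LBracket of lie_term & lie_term.

(* The least congruence containing [E] whose quotient is a Lie algebra. *)
Inductive lie_eqv (E : lie_term -> lie_term -> Prop) :
  lie_term -> lie_term -> Prop :=
| lie_rel u v : E u v -> lie_eqv E u v
| lie_refl u : lie_eqv E u u
| lie_sym u v : lie_eqv E u v -> lie_eqv E v u
| lie_trans u v w : lie_eqv E u v -> lie_eqv E v w -> lie_eqv E u w
| lie_congrD u u' v v' : lie_eqv E u u' -> lie_eqv E v v' ->
    lie_eqv E (LAdd u v) (LAdd u' v')
| lie_congrZ k u u' : lie_eqv E u u' ->
    lie_eqv E (LScale k u) (LScale k u')
| lie_congrB u u' v v' : lie_eqv E u u' -> lie_eqv E v v' ->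
    lie_eqv E (LBracket u v) (LBracket u' v')
| lie_addA u v w : lie_eqv E (LAdd u (LAdd v w)) (LAdd (LAdd u v) w)
| lie_addC u v : lie_eqv E (LAdd u v) (LAdd v u)
| lie_add0 u : lie_eqv E (LAdd LZero u) u
| lie_addN u : lie_eqv E (LAdd (LScale (-1) u) u) LZero
| lie_scaleA k l u :
    lie_eqv E (LScale k (LScale l u)) (LScale (k * l) u)
| lie_scale1 u : lie_eqv E (LScale 1 u) u
| lie_scaleDr k u v :
    lie_eqv E (LScale k (LAdd u v)) (LAdd (LScale k u) (LScale k v))
| lie_scaleDl k l u :
    lie_eqv E (LScale (k + l) u) (LAdd (LScale k u) (LScale l u))
| lie_bracketl k u v w :
    lie_eqv E (LBracket (LAdd (LScale k u) v) w)
                (LAdd (LScale k (LBracket u w)) (LBracket v w))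
| lie_bracketr k u v w :
    lie_eqv E (LBracket w (LAdd (LScale k u) v))
                (LAdd (LScale k (LBracket w u)) (LBracket w v))
| lie_bracketvv u : lie_eqv E (LBracket u u) LZero
| lie_jacobi u v w :
    lie_eqv E (LAdd (LAdd (LBracket u (LBracket v w))
                            (LBracket v (LBracket w u)))
                      (LBracket w (LBracket u v))) LZero.

HB.instance Definition _ := gen_eqMixin lie_term.
HB.instance Definition _ := gen_choiceMixin lie_term.

End PresentedLie.

Section PresentedLieQuotient.
Context (K : comPzRingType) (X : Type).
Context (E : lie_term K X -> lie_term K X -> Prop).
Local Notation term := (lie_term K X).

Definition lie_eqvb : rel term := fun u v => `[< lie_eqv E u v >].

Lemma lie_eqvb_equiv : equiv_class_of lie_eqvb.
Proof.
split=> [u|u v|v u w].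
- by apply/asboolP; apply: lie_refl.
- by apply/asboolP/asboolP; apply: lie_sym.
- by move=> /asboolP h /asboolP h'; apply/asboolP; apply: lie_trans h h'.
Qed.

Canonical lie_equiv : equiv_rel term := EquivRelPack lie_eqvb_equiv.

Definition presented_lie : Type := {eq_quot lie_equiv}.
HB.instance Definition _ := Choice.on presented_lie.
HB.instance Definition _ := Quotient.on presented_lie.
HB.instance Definition _ : EqQuotient _ lie_equiv presented_lie :=
  EqQuotient.on presented_lie.

Definition lie_class (u : term) : presented_lie := \pi_presented_lie u.

Lemma lie_classP u v : lie_class u = lie_class v <-> lie_eqv E u v.
Proof. by split=> [/eqmodP/asboolP//|h]; apply/eqmodP/asboolP. Qed.

Lemma lie_class_repr (p : presented_lie) : lie_class (repr p) = p.
Proof. exact: reprK. Qed.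

Lemma lie_repr_class u : lie_eqv E (repr (lie_class u)) u.
Proof. by apply/lie_classP; rewrite lie_class_repr. Qed.

Definition pl_add (p q : presented_lie) := lie_class (LAdd (repr p) (repr q)).
Definition pl_scale k (p : presented_lie) := lie_class (LScale k (repr p)).
Definition pl_opp (p : presented_lie) := pl_scale (-1) p.
Definition pl_bracket (p q : presented_lie) :=
  lie_class (LBracket (repr p) (repr q)).

Lemma pl_addE u v :
  pl_add (lie_class u) (lie_class v) = lie_class (LAdd u v).
Proof. by apply/lie_classP/lie_congrD; apply: lie_repr_class. Qed.

Lemma pl_scaleE k u : pl_scale k (lie_class u) = lie_class (LScale k u).
Proof. by apply/lie_classP/lie_congrZ; apply: lie_repr_class. Qed.

Lemma pl_bracketE u v :
  pl_bracket (lie_class u) (lie_class v) = lie_class (LBracket u v).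
Proof. by apply/lie_classP/lie_congrB; apply: lie_repr_class. Qed.

Let plE := (pl_addE, pl_scaleE, pl_bracketE).

Lemma pl_addA : associative pl_add.
Proof.
move=> p q r; rewrite -(lie_class_repr p) -(lie_class_repr q).
by rewrite -(lie_class_repr r) !plE; apply/lie_classP/lie_addA.
Qed.

Lemma pl_addC : commutative pl_add.
Proof.
move=> p q; rewrite -(lie_class_repr p) -(lie_class_repr q) !plE.
exact/lie_classP/lie_addC.
Qed.

Lemma pl_add0 : left_id (lie_class (LZero K X)) pl_add.
Proof.
by move=> p; rewrite -(lie_class_repr p) !plE; apply/lie_classP/lie_add0.
Qed.

Lemma pl_addN : left_inverse (lie_class (LZero K X)) pl_opp pl_add.
Proof.
move=> p; rewrite /pl_opp -(lie_class_repr p) !plE.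
exact/lie_classP/lie_addN.
Qed.

HB.instance Definition _ :=
  GRing.isZmodule.Build presented_lie pl_addA pl_addC pl_add0 pl_addN.

Lemma pl_scaleA a b p : pl_scale a (pl_scale b p) = pl_scale (a * b) p.
Proof. by rewrite -(lie_class_repr p) !plE; apply/lie_classP/lie_scaleA. Qed.

Lemma pl_scale1 : left_id 1 pl_scale.
Proof.
by move=> p; rewrite -(lie_class_repr p) !plE; apply/lie_classP/lie_scale1.
Qed.

Lemma pl_scaleDr : right_distributive pl_scale +%R.
Proof.
move=> k p q; rewrite -[LHS]/(pl_scale k (pl_add p q)).
rewrite -[RHS]/(pl_add (pl_scale k p) (pl_scale k q)).
rewrite -(lie_class_repr p) -(lie_class_repr q) !plE.
exact/lie_classP/lie_scaleDr.
Qed.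

Lemma pl_scaleDl p : {morph pl_scale^~ p : a b / a + b}.
Proof.
move=> a b; rewrite -[RHS]/(pl_add (pl_scale a p) (pl_scale b p)).
by rewrite -(lie_class_repr p) !plE; apply/lie_classP/lie_scaleDl.
Qed.

HB.instance Definition _ :=
  GRing.Zmodule_isLmodule.Build K presented_lie
    pl_scaleA pl_scale1 pl_scaleDr pl_scaleDl.

Lemma pl_bracketl (a : K) (p q r : presented_lie) :
  pl_bracket (a *: p + q) r = a *: pl_bracket p r + pl_bracket q r.
Proof.
rewrite -[LHS]/(pl_bracket (pl_add (pl_scale a p) q) r).
rewrite -[RHS]/(pl_add (pl_scale a (pl_bracket p r)) (pl_bracket q r)).
rewrite -(lie_class_repr p) -(lie_class_repr q) -(lie_class_repr r) !plE.
exact/lie_classP/lie_bracketl.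
Qed.

Lemma pl_bracketr (a : K) (p q r : presented_lie) :
  pl_bracket r (a *: p + q) = a *: pl_bracket r p + pl_bracket r q.
Proof.
rewrite -[LHS]/(pl_bracket r (pl_add (pl_scale a p) q)).
rewrite -[RHS]/(pl_add (pl_scale a (pl_bracket r p)) (pl_bracket r q)).
rewrite -(lie_class_repr p) -(lie_class_repr q) -(lie_class_repr r) !plE.
exact/lie_classP/lie_bracketr.
Qed.

Lemma pl_bracketvv (p : presented_lie) : pl_bracket p p = 0.
Proof.
rewrite -(lie_class_repr p) plE; exact/lie_classP/lie_bracketvv.
Qed.

Lemma pl_jacobi (p q r : presented_lie) :
  pl_bracket p (pl_bracket q r) + pl_bracket q (pl_bracket r p)
    + pl_bracket r (pl_bracket p q) = 0.
Proof.
rewrite -[LHS]/(pl_add (pl_add (pl_bracket p (pl_bracket q r))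
  (pl_bracket q (pl_bracket r p))) (pl_bracket r (pl_bracket p q))).
rewrite -(lie_class_repr p) -(lie_class_repr q) -(lie_class_repr r) !plE.
exact/lie_classP/lie_jacobi.
Qed.

HB.instance Definition _ :=
  Lmodule_isLie.Build K presented_lie
    pl_bracketl pl_bracketr pl_bracketvv pl_jacobi.

End PresentedLieQuotient.

Section PresentedAlgebra.
Context (K : comPzRingType) (X : Type).

Inductive alg_term : Type :=
| AGen of X
| AZero
| AOne
| AAdd of alg_term & alg_term
| AScale of K & alg_term
| AMul of alg_term & alg_term.

(* The least congruence containing [E] whose quotient is a unital algebra. *)
Inductive alg_eqv (E : alg_term -> alg_term -> Prop) :
  alg_term -> alg_term -> Prop :=
| alg_rel u v : E u v -> alg_eqv E u v
| alg_refl u : alg_eqv E u u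
| alg_sym u v : alg_eqv E u v -> alg_eqv E v u
| alg_trans u v w : alg_eqv E u v -> alg_eqv E v w -> alg_eqv E u w
| alg_congrD u u' v v' : alg_eqv E u u' -> alg_eqv E v v' ->
    alg_eqv E (AAdd u v) (AAdd u' v')
| alg_congrZ k u u' : alg_eqv E u u' -> alg_eqv E (AScale k u) (AScale k u')
| alg_congrM u u' v v' : alg_eqv E u u' -> alg_eqv E v v' ->
    alg_eqv E (AMul u v) (AMul u' v')
| alg_addA u v w : alg_eqv E (AAdd u (AAdd v w)) (AAdd (AAdd u v) w)
| alg_addC u v : alg_eqv E (AAdd u v) (AAdd v u)
| alg_add0 u : alg_eqv E (AAdd AZero u) u
| alg_addN u : alg_eqv E (AAdd (AScale (-1) u) u) AZero
| alg_scaleA k l u : alg_eqv E (AScale k (AScale l u)) (AScale (k * l) u)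
| alg_scale1 u : alg_eqv E (AScale 1 u) u
| alg_scaleDr k u v :
    alg_eqv E (AScale k (AAdd u v)) (AAdd (AScale k u) (AScale k v))
| alg_scaleDl k l u :
    alg_eqv E (AScale (k + l) u) (AAdd (AScale k u) (AScale l u))
| alg_mulA u v w : alg_eqv E (AMul u (AMul v w)) (AMul (AMul u v) w)
| alg_mul1l u : alg_eqv E (AMul AOne u) u
| alg_mul1r u : alg_eqv E (AMul u AOne) u
| alg_mulDl u v w : alg_eqv E (AMul (AAdd u v) w) (AAdd (AMul u w) (AMul v w))
| alg_mulDr u v w : alg_eqv E (AMul w (AAdd u v)) (AAdd (AMul w u) (AMul w v))
| alg_scaleAl k u v : alg_eqv E (AScale k (AMul u v)) (AMul (AScale k u) v)
| alg_scaleAr k u v : alg_eqv E (AScale k (AMul u v)) (AMul u (AScale k v)).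

HB.instance Definition _ := gen_eqMixin alg_term.
HB.instance Definition _ := gen_choiceMixin alg_term.

End PresentedAlgebra.

Section PresentedAlgebraQuotient.
Context (K : comPzRingType) (X : Type).
Context (E : alg_term K X -> alg_term K X -> Prop).
Local Notation term := (alg_term K X).

Definition alg_eqvb : rel term := fun u v => `[< alg_eqv E u v >].

Lemma alg_eqvb_equiv : equiv_class_of alg_eqvb.
Proof.
split=> [u|u v|v u w].
- by apply/asboolP; apply: alg_refl.
- by apply/asboolP/asboolP; apply: alg_sym.
- by move=> /asboolP h /asboolP h'; apply/asboolP; apply: alg_trans h h'.
Qed.

Canonical alg_equiv : equiv_rel term := EquivRelPack alg_eqvb_equiv.

(* MathComp's [algType] requires 1 != 0, so only the ring and module
   structures are put on [presented_alg] in general. *)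
Definition presented_alg : Type := {eq_quot alg_equiv}.
HB.instance Definition _ := Choice.on presented_alg.
HB.instance Definition _ := Quotient.on presented_alg.
HB.instance Definition _ : EqQuotient _ alg_equiv presented_alg :=
  EqQuotient.on presented_alg.

Definition alg_class (u : term) : presented_alg := \pi_presented_alg u.

Lemma alg_classP u v : alg_class u = alg_class v <-> alg_eqv E u v.
Proof. by split=> [/eqmodP/asboolP//|h]; apply/eqmodP/asboolP. Qed.

Lemma alg_class_repr (p : presented_alg) : alg_class (repr p) = p.
Proof. exact: reprK. Qed.

Lemma alg_repr_class u : alg_eqv E (repr (alg_class u)) u.
Proof. by apply/alg_classP; rewrite alg_class_repr. Qed.

Definition pa_add (p q : presented_alg) := alg_class (AAdd (repr p) (repr q)).
Definition pa_scale k (p : presented_alg) := alg_class (AScale k (repr p)).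
Definition pa_opp (p : presented_alg) := pa_scale (-1) p.
Definition pa_mul (p q : presented_alg) := alg_class (AMul (repr p) (repr q)).

Lemma pa_addE u v :
  pa_add (alg_class u) (alg_class v) = alg_class (AAdd u v).
Proof. by apply/alg_classP/alg_congrD; apply: alg_repr_class. Qed.

Lemma pa_scaleE k u : pa_scale k (alg_class u) = alg_class (AScale k u).
Proof. by apply/alg_classP/alg_congrZ; apply: alg_repr_class. Qed.

Lemma pa_mulE u v :
  pa_mul (alg_class u) (alg_class v) = alg_class (AMul u v).
Proof. by apply/alg_classP/alg_congrM; apply: alg_repr_class. Qed.

Let paE := (pa_addE, pa_scaleE, pa_mulE).

Lemma pa_addA : associative pa_add.
Proof.
move=> p q r; rewrite -(alg_class_repr p) -(alg_class_repr q).
by rewrite -(alg_class_repr r) !paE; apply/alg_classP/alg_addA.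
Qed.

Lemma pa_addC : commutative pa_add.
Proof.
move=> p q; rewrite -(alg_class_repr p) -(alg_class_repr q) !paE.
exact/alg_classP/alg_addC.
Qed.

Lemma pa_add0 : left_id (alg_class (AZero K X)) pa_add.
Proof.
by move=> p; rewrite -(alg_class_repr p) !paE; apply/alg_classP/alg_add0.
Qed.

Lemma pa_addN : left_inverse (alg_class (AZero K X)) pa_opp pa_add.
Proof.
move=> p; rewrite /pa_opp -(alg_class_repr p) !paE.
exact/alg_classP/alg_addN.
Qed.

HB.instance Definition _ :=
  GRing.isZmodule.Build presented_alg pa_addA pa_addC pa_add0 pa_addN.

Lemma pa_mulA : associative pa_mul.
Proof.
move=> p q r; rewrite -(alg_class_repr p) -(alg_class_repr q).
by rewrite -(alg_class_repr r) !paE; apply/alg_classP/alg_mulA.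
Qed.

Lemma pa_mul1l : left_id (alg_class (AOne K X)) pa_mul.
Proof.
by move=> p; rewrite -(alg_class_repr p) !paE; apply/alg_classP/alg_mul1l.
Qed.

Lemma pa_mul1r : right_id (alg_class (AOne K X)) pa_mul.
Proof.
by move=> p; rewrite -(alg_class_repr p) !paE; apply/alg_classP/alg_mul1r.
Qed.

Lemma pa_mulDl : left_distributive pa_mul +%R.
Proof.
move=> p q r; rewrite -[LHS]/(pa_mul (pa_add p q) r).
rewrite -[RHS]/(pa_add (pa_mul p r) (pa_mul q r)) -(alg_class_repr p).
rewrite -(alg_class_repr q) -(alg_class_repr r) !paE.
exact/alg_classP/alg_mulDl.
Qed.

Lemma pa_mulDr : right_distributive pa_mul +%R.
Proof.
move=> p q r; rewrite -[LHS]/(pa_mul p (pa_add q r)).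
rewrite -[RHS]/(pa_add (pa_mul p q) (pa_mul p r)) -(alg_class_repr p).
rewrite -(alg_class_repr q) -(alg_class_repr r) !paE.
exact/alg_classP/alg_mulDr.
Qed.

HB.instance Definition _ :=
  GRing.Zmodule_isPzRing.Build presented_alg
    pa_mulA pa_mul1l pa_mul1r pa_mulDl pa_mulDr.

Lemma pa_scaleA a b p : pa_scale a (pa_scale b p) = pa_scale (a * b) p.
Proof. by rewrite -(alg_class_repr p) !paE; apply/alg_classP/alg_scaleA. Qed.

Lemma pa_scale1 : left_id 1 pa_scale.
Proof.
by move=> p; rewrite -(alg_class_repr p) !paE; apply/alg_classP/alg_scale1.
Qed.

Lemma pa_scaleDr : right_distributive pa_scale +%R.
Proof.
move=> k p q; rewrite -[LHS]/(pa_scale k (pa_add p q)).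
rewrite -[RHS]/(pa_add (pa_scale k p) (pa_scale k q)).
rewrite -(alg_class_repr p) -(alg_class_repr q) !paE.
exact/alg_classP/alg_scaleDr.
Qed.

Lemma pa_scaleDl p : {morph pa_scale^~ p : a b / a + b}.
Proof.
move=> a b; rewrite -[RHS]/(pa_add (pa_scale a p) (pa_scale b p)).
by rewrite -(alg_class_repr p) !paE; apply/alg_classP/alg_scaleDl.
Qed.

HB.instance Definition _ :=
  GRing.Zmodule_isLmodule.Build K presented_alg
    pa_scaleA pa_scale1 pa_scaleDr pa_scaleDl.

Lemma presented_alg_scalerAl (a : K) (p q : presented_alg) :
  a *: (p * q) = (a *: p) * q.
Proof.
rewrite -[LHS]/(pa_scale a (pa_mul p q)) -[RHS]/(pa_mul (pa_scale a p) q).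
rewrite -(alg_class_repr p) -(alg_class_repr q) !paE.
exact/alg_classP/alg_scaleAl.
Qed.

Lemma presented_alg_scalerAr (a : K) (p q : presented_alg) :
  a *: (p * q) = p * (a *: q).
Proof.
rewrite -[LHS]/(pa_scale a (pa_mul p q)) -[RHS]/(pa_mul p (pa_scale a q)).
rewrite -(alg_class_repr p) -(alg_class_repr q) !paE.
exact/alg_classP/alg_scaleAr.
Qed.

End PresentedAlgebraQuotient.

Definition pairing (F : pzRingType) (n : nat)
  (x : 'rV[F]_n) (u : 'cV[F]_n) : F := (x *m u) ord0 ord0.

Definition cplx (R : realType) (m n : nat) (A : 'M[R]_(m, n)) : 'M[R[i]]_(m, n) :=
  map_mx (real_complex R) A.

(* A root system in [V = 'rV[R]_n]; the dual of [V] is ['cV[R]_n].  The values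
   of [coroot] outside the roots are irrelevant; on the roots they are
   determined by the other data. *)
Record root_system (R : realType) (n : nat) := RootSystem {
  root_set : {fset 'rV[R]_n};
  coroot : 'rV[R]_n -> 'cV[R]_n;
  roots_span : <<enum_fset root_set>>%VS = fullv;
  roots_neq0 : 0 \notin root_set;
  pairing_coroot : forall a, a \in root_set -> pairing a (coroot a) = 2;
  roots_refl : forall a b, a \in root_set -> b \in root_set ->
    b - pairing b (coroot a) *: a \in root_set;
  roots_crystallographic : forall a b, a \in root_set -> b \in root_set ->
    pairing b (coroot a) \is a Num.int;
  roots_reduced : forall (a : 'rV[R]_n) (k : R),
    a \in root_set -> k *: a \in root_set -> k = 1 \/ k = -1
}.

Section RootSystem.
Context (R : realType) (n : nat) (Phi : root_system R n).
Implicit Types (a b : 'rV[R]_n) (Psi : {fset 'rV[R]_n}).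

Definition irreducible_root_system : Prop :=
  root_set Phi != fset0 /\
  forall A : {fset 'rV[R]_n}, (A `<=` root_set Phi)%fset -> A != fset0 ->
    (forall a b, a \in A -> b \in (root_set Phi `\` A)%fset ->
       pairing b (coroot Phi a) = 0) ->
    A = root_set Phi.

Definition in_Zspan Psi (v : 'rV[R]_n) : Prop :=
  exists k : 'rV[R]_n -> int, v = \sum_(b <- Psi) b *~ k b.

Definition root_subsystem Psi : Prop :=
  forall a, a \in Psi <-> in_Zspan Psi a /\ a \in root_set Phi.

Definition root_rank Psi : nat := \dim <<enum_fset Psi>>%VS.

(* The reflection [u |-> u - <a, u> a^vee], acting on columns on the left. *)
Definition refl a : 'M[R]_n := 1%:M - coroot Phi a *m a.

(* The Weyl group, acting on ['cV[R]_n] on the left.  It acts on ['rV[R]_n] by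
   [x |-> x *m invmx w].  Reflections are involutions, so products of
   reflections form a group. *)
Inductive in_weyl : 'M[R]_n -> Prop :=
| weyl1 : in_weyl 1%:M
| weylM a w : a \in root_set Phi -> in_weyl w -> in_weyl (refl a *m w).

Definition weyl : Type := {w : 'M[R]_n | in_weyl w}.

Definition reflections : {fset 'M[R]_n} :=
  [fset refl a | a in root_set Phi]%fset.

Lemma in_weyl_reflection (s : reflections) : in_weyl (val s).
Proof.
case/imfsetP: (valP s) => a ha ->.
by rewrite -[refl a]mulmx1; apply: weylM => //; apply: weyl1.
Qed.

Definition reflection_weyl (s : reflections) : weyl :=
  exist _ (val s) (in_weyl_reflection s).

Lemma refl_in_reflections (a : root_set Phi) : refl (val a) \in reflections.
Proof. by apply/imfsetP; exists (val a) => //; apply: valP. Qed.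

Definition root_reflection (a : root_set Phi) : reflections :=
  [` refl_in_reflections a]%fset.

Record simple_system := SimpleSystem {
  simple :> 'I_n -> 'rV[R]_n;
  simple_root : forall i, simple i \in root_set Phi;
  simple_basis : basis_of fullv [tuple simple i | i < n];
  simple_sign : forall a, a \in root_set Phi ->
    (exists k : 'I_n -> nat, a = \sum_(i < n) simple i *+ k i) \/
    (exists k : 'I_n -> nat, a = - \sum_(i < n) simple i *+ k i)
}.

Context (Delta : simple_system).

Definition nonneg_comb (v : 'rV[R]_n) : Prop :=
  exists k : 'I_n -> nat, v = \sum_(i < n) Delta i *+ k i.

Definition pos_roots : {fset 'rV[R]_n} :=
  [fset a in root_set Phi | `[< nonneg_comb a >]]%fset.

Definition highest_root (theta : 'rV[R]_n) : Prop :=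
  theta \in root_set Phi /\
  forall b, b \in root_set Phi -> nonneg_comb (theta - b).

(* The positive root [a] such that [s = refl a]; it is unique. *)
Definition reflection_root (s : reflections) : 'rV[R]_n :=
  head 0 [seq a <- pos_roots | refl a == val s].

Local Notation C := R[i].

Inductive tell_gen : Type :=
| tgen_t of root_set Phi
| tgen_x of 'cV[C]_n
| tgen_y of 'cV[C]_n.

Local Notation lterm := (lie_term C tell_gen).
Local Notation lt a := (LGen C (tgen_t a)).
Local Notation lx u := (LGen C (tgen_x u)).
Local Notation ly u := (LGen C (tgen_y u)).
Local Notation lzero := (LZero C tell_gen).

Inductive tell_rel : lterm -> lterm -> Prop :=
| tell_tN (a b : root_set Phi) : val b = - val a -> tell_rel (lt b) (lt a)
| tell_xlin k (u v : 'cV[C]_n) :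
    tell_rel (lx (k *: u + v)) (LAdd (LScale k (lx u)) (lx v))
| tell_ylin k (u v : 'cV[C]_n) :
    tell_rel (ly (k *: u + v)) (LAdd (LScale k (ly u)) (ly v))
| tell_tt Psi (a : root_set Phi) :
    root_subsystem Psi -> root_rank Psi = 2%N -> val a \in Psi ->
    tell_rel
      (LBracket (lt a)
         (\big[@LAdd _ _/lzero]_(b : root_set Phi |
            (val b \in Psi) && (val b \in pos_roots)) lt b))
      lzero
| tell_xx u v : tell_rel (LBracket (lx u) (lx v)) lzero
| tell_yy u v : tell_rel (LBracket (ly u) (ly v)) lzero
| tell_yx u v :
    tell_rel (LBracket (ly u) (lx v))
      (\big[@LAdd _ _/lzero]_(c : root_set Phi | val c \in pos_roots)
         LScale (pairing (cplx (val c)) v * pairing (cplx (val c)) u) (lt c))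
| tell_tx (a : root_set Phi) u :
    pairing (cplx (val a)) u = 0 -> tell_rel (LBracket (lt a) (lx u)) lzero
| tell_ty (a : root_set Phi) u :
    pairing (cplx (val a)) u = 0 -> tell_rel (LBracket (lt a) (ly u)) lzero.

Definition tell : Type := presented_lie tell_rel.
HB.instance Definition _ := LieAlgebra.on tell.

Definition tell_t (a : root_set Phi) : tell := lie_class tell_rel (lt a).
Definition tell_x (v : 'cV[C]_n) : tell := lie_class tell_rel (lx v).
Definition tell_y (u : 'cV[C]_n) : tell := lie_class tell_rel (ly u).

(* [hgen_w], [hgen_x] and [hgen_y] generate the smash product of the group algebra
   of the Weyl group with the tensor algebra of [h (+) h^*]; [hgen_c] and
   [hgen_hbar] are the standard coordinates generating the polynomial functions
   on the parameter space. *)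
Inductive rca_gen : Type :=
| hgen_w of weyl
| hgen_x of 'rV[C]_n
| hgen_y of 'cV[C]_n
| hgen_c of reflections
| hgen_hbar.

Local Notation aterm := (alg_term C rca_gen).
Local Notation aw w := (AGen C (hgen_w w)).
Local Notation ax x := (AGen C (hgen_x x)).
Local Notation ay y := (AGen C (hgen_y y)).
Local Notation ac s := (AGen C (hgen_c s)).
Local Notation ahbar := (AGen C hgen_hbar).
Local Notation asub u v := (AAdd u (AScale (-1) v)).

Inductive rca_rel : aterm -> aterm -> Prop :=
| rca_w1 w : sval w = 1%:M -> rca_rel (aw w) (AOne C rca_gen)
| rca_wM w1 w2 w : sval w = sval w1 *m sval w2 ->
    rca_rel (AMul (aw w1) (aw w2)) (aw w)
| rca_xlin k (x x' : 'rV[C]_n) :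
    rca_rel (ax (k *: x + x')) (AAdd (AScale k (ax x)) (ax x'))
| rca_ylin k (y y' : 'cV[C]_n) :
    rca_rel (ay (k *: y + y')) (AAdd (AScale k (ay y)) (ay y'))
| rca_wx w x :
    rca_rel (AMul (aw w) (ax x))
            (AMul (ax (x *m invmx (cplx (sval w)))) (aw w))
| rca_wy w y :
    rca_rel (AMul (aw w) (ay y)) (AMul (ay (cplx (sval w) *m y)) (aw w))
| rca_hbar_central g :
    rca_rel (AMul ahbar (AGen C g)) (AMul (AGen C g) ahbar)
| rca_c_central s g :
    rca_rel (AMul (ac s) (AGen C g)) (AMul (AGen C g) (ac s))
| rca_c_conj (s s' : reflections) (w : weyl) :
    val s' = sval w *m val s *m invmx (sval w) -> rca_rel (ac s') (ac s)
| rca_xx x x' :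
    rca_rel (asub (AMul (ax x) (ax x')) (AMul (ax x') (ax x))) (AZero C rca_gen)
| rca_yy y y' :
    rca_rel (asub (AMul (ay y) (ay y')) (AMul (ay y') (ay y))) (AZero C rca_gen)
| rca_yx y x :
    rca_rel
      (asub (AMul (ay y) (ax x)) (AMul (ax x) (ay y)))
      (asub (AScale (pairing x y) ahbar)
        (\big[@AAdd _ _/AZero C rca_gen]_(s : reflections)
           AScale (pairing (cplx (reflection_root s)) y *
                   pairing x (cplx (coroot Phi (reflection_root s))))
             (AMul (ac s) (aw (reflection_weyl s))))).

Definition rca : Type := presented_alg rca_rel.
HB.instance Definition _ := GRing.PzRing.on rca.
HB.instance Definition _ := GRing.Lmodule.on rca.

Fixpoint rca_augmentation (u : aterm) : C :=
  match u with
  | AGen (hgen_w _) => 1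
  | AGen _ => 0
  | AZero => 0
  | AOne => 1
  | AAdd u v => rca_augmentation u + rca_augmentation v
  | AScale k u => k * rca_augmentation u
  | AMul u v => rca_augmentation u * rca_augmentation v
  end.

Lemma rca_augmentation_eqv u v :
  alg_eqv rca_rel u v -> rca_augmentation u = rca_augmentation v.
Proof.
elim=> {u v} /=.
- move=> u v [] /=; try by move=> *; rewrite ?(mulr0, mul0r, mulr1, addr0).
  move=> y x; rewrite !mulr0 !add0r.
  set S := \big[_/_]_s _.
  suff -> : rca_augmentation S = 0 by rewrite mulr0.
  rewrite /S; elim/big_ind: _ => //= [p q -> ->|s _]; first exact: addr0.
  by rewrite mul0r mulr0.
- by [].
- by move=> u v _ ->.
- by move=> u v w _ -> _ ->.
- by move=> u u' v v' _ -> _ ->.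
- by move=> k u u' _ ->.
- by move=> u u' v v' _ -> _ ->.
- by move=> u v w; apply: addrA.
- by move=> u v; apply: addrC.
- by move=> u; apply: add0r.
- by move=> u; rewrite mulN1r addNr.
- by move=> k l u; apply: mulrA.
- by move=> u; apply: mul1r.
- by move=> k u v; apply: mulrDr.
- by move=> k l u; apply: mulrDl.
- by move=> u v w; apply: mulrA.
- by move=> u; apply: mul1r.
- by move=> u; apply: mulr1.
- by move=> u v w; apply: mulrDl.
- by move=> u v w; apply: mulrDr.
- by move=> k u v; apply: mulrA.
- by move=> k u v; apply: mulrCA.
Qed.

Lemma rca_oner_neq0 : 1 != 0 :> rca.
Proof.
apply/eqP => /alg_classP/rca_augmentation_eqv /= /eqP.
by rewrite oner_eq0.
Qed.

HB.instance Definition _ := GRing.PzSemiRing_isNonZero.Build rca rca_oner_neq0.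
HB.instance Definition _ :=
  GRing.Lmodule_isLalgebra.Build C rca (@presented_alg_scalerAl _ _ rca_rel).
HB.instance Definition _ :=
  GRing.Lalgebra_isAlgebra.Build C rca (@presented_alg_scalerAr _ _ rca_rel).
HB.instance Definition _ : Lmodule_isLie C rca := commutator_lie_mixin rca.

Definition rca_w (w : weyl) : rca := alg_class rca_rel (aw w).
Definition rca_x (x : 'rV[C]_n) : rca := alg_class rca_rel (ax x).
Definition rca_y (y : 'cV[C]_n) : rca := alg_class rca_rel (ay y).
Definition rca_c (s : reflections) : rca := alg_class rca_rel (ac s).
Definition rca_hbar : rca := alg_class rca_rel ahbar.

End RootSystem.

Section Form.
Context (F : fieldType) (n : nat) (B : 'M[F]_n).

Definition bform (u v : 'cV[F]_n) : F := (u^T *m B *m v) ord0 ord0.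

(* [v] is sent to the linear form [(v | _)]. *)
Definition bform_iso (v : 'cV[F]_n) : 'rV[F]_n := v^T *m B.

(* The form on row vectors for which [bform_iso] is an isometry. *)
Definition bform_dual (x y : 'rV[F]_n) : F :=
  (x *m invmx B *m y^T) ord0 ord0.

End Form.

(* Main.v *)
Require Import Defs.
From mathcomp Require Import all_boot all_order all_algebra.
From mathcomp Require Import finmap boolp reals complex.

Set Implicit Arguments.
Unset Strict Implicit.
Unset Printing Implicit Defensive.

Import GRing.Theory.
Local Open Scope ring_scope.
Import Order.TTheory Num.Theory.

(** A homomorphism out of a Lie algebra given by generators and relations is
    an assignment of the generators that satisfies the relations ([lie_lift]),
    so each defining relation of the elliptic holonomy Lie algebra has to be
    checked in the Cherednik algebra.  Write
      [t_c = hbar / h - k_c c_(s_c) s_c]  with  [k_c = 2 / (c | c)].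

    - The rank 2 relations: [hbar] and the parameters are central, the weights
      [k_c] and the parameters are constant on Weyl orbits, so that
      [s_a t_b = t_(s_a b) s_a].  A root subsystem is stable under its own
      reflections, and [t_(-b) = t_b], so the sum of the [t_b] over its positive
      roots is half the sum over all of it and commutes with [s_a]
      ([cherednik_t_subsystem]).
    - If [a] vanishes on [u], then [s_a] fixes [u] and its image in the dual, so
      [t_a] commutes with [x u] and [y u].
    - The relation for [[y u, x v]]: the defining relation of the Cherednik
      algebra has the same reflection part, because
      [<c^vee, pi v> = k_c <c, v>].  The [hbar] parts agree because
      [sum_(c > 0) <c, u> <c, v> = h (u | v)]  ([sum_pos_roots_bform]).

    The last identity is the heart of the matter.  Both sides are invariant
    under all reflections.  A form [M] with this property satisfies
    [2 M(a^vee, v) = M(a^vee, a^vee) <a, v>] for every root [a]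
    ([invariant_form_coroot]); hence the ratio [M(a^vee, a^vee) / B(a^vee, a^vee)]
    agrees on any two roots that are not orthogonal, and it is constant when the
    root system is irreducible ([invariant_form_unique]).  The two sides are
    therefore proportional, and the factor is found at the coroot of the
    highest root [theta]: every positive root other than [theta] pairs to 0 or 1
    with [theta^vee], so the squares on the left can be replaced by the pairings
    themselves up to the correction at [theta], and
    [sum_(c > 0) <c, alpha_i^vee> = 2] for each simple root [alpha_i]
    ([root_gram_highest_coroot]).

    The same remark on invariant forms, applied to the positive definite form
    [sum_c <c, u> <c, v>] ([root_gram]), shows that coroots are determined by
    their roots, which gives the equivariance of [a |-> a^vee]. *)

(** * Homomorphisms out of a presented Lie algebra *)

Section LiePresentation.
Context (K : comPzRingType) (X : Type) (E : lie_term K X -> lie_term K X -> Prop).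
Context (L : lieAlgType K) (phi : X -> L).

Fixpoint lie_eval (t : lie_term K X) : L :=
  match t with
  | LGen x => phi x
  | LZero => 0
  | LAdd t1 t2 => lie_eval t1 + lie_eval t2
  | LScale k t1 => k *: lie_eval t1
  | LBracket t1 t2 => bracket (lie_eval t1) (lie_eval t2)
  end.

Lemma lie_eval_sum (I : finType) (P : pred I) (F : I -> lie_term K X) :
  lie_eval (\big[@LAdd _ _/LZero K X]_(i | P i) F i) =
    \sum_(i | P i) lie_eval (F i).
Proof. exact: (big_morph lie_eval). Qed.

Hypothesis phi_rel : forall t1 t2, E t1 t2 -> lie_eval t1 = lie_eval t2.

Lemma lie_eval_eqv t1 t2 : lie_eqv E t1 t2 -> lie_eval t1 = lie_eval t2.
Proof.
elim=> {t1 t2} /=; first exact: phi_rel.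
- by [].
- by move=> u v _ ->.
- by move=> u v w _ -> _ ->.
- by move=> u u' v v' _ -> _ ->.
- by move=> k u u' _ ->.
- by move=> u u' v v' _ -> _ ->.
- by move=> *; rewrite addrA.
- by move=> *; rewrite addrC.
- by move=> *; rewrite add0r.
- by move=> u; rewrite scaleN1r addNr.
- by move=> *; rewrite scalerA.
- by move=> *; rewrite scale1r.
- by move=> *; rewrite scalerDr.
- by move=> *; rewrite scalerDl.
- by move=> *; rewrite bracket_linearl.
- by move=> *; rewrite bracket_linearr.
- by move=> *; rewrite bracketvv.
- by move=> *; rewrite jacobi.
Qed.

Definition lie_lift (p : presented_lie E) : L := lie_eval (repr p).

Lemma lie_lift_class t : lie_lift (lie_class E t) = lie_eval t.
Proof. exact/lie_eval_eqv/lie_repr_class. Qed.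

Lemma lie_lift_hom : lie_hom lie_lift.
Proof.
have liftD p q : lie_lift (pl_add p q) = lie_lift p + lie_lift q.
  exact: lie_lift_class.
have liftZ k p : lie_lift (pl_scale k p) = k *: lie_lift p.
  exact: lie_lift_class.
split=> [k p q|p q]; last exact: lie_lift_class.
by rewrite -liftZ -liftD.
Qed.

End LiePresentation.

(** * Pairings, reflections and bilinear forms *)

Section Pairing.
Context (F : comPzRingType) (n : nat).
Implicit Types (x y : 'rV[F]_n) (u v : 'cV[F]_n).

Lemma pairing_mul x u : x *m u = (pairing x u)%:M.
Proof. exact: mx11_scalar. Qed.

Lemma pairingNl x u : pairing (- x) u = - pairing x u.
Proof. by rewrite /pairing mulNmx mxE. Qed.

Lemma pairingNr x u : pairing x (- u) = - pairing x u.
Proof. by rewrite /pairing mulmxN mxE. Qed.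

Lemma pairingZl k x u : pairing (k *: x) u = k * pairing x u.
Proof. by rewrite /pairing -scalemxAl mxE. Qed.

Lemma pairingZr k x u : pairing x (k *: u) = k * pairing x u.
Proof. by rewrite /pairing -scalemxAr mxE. Qed.

Lemma pairing_sumr (I : finType) (P : pred I) (f : I -> 'cV[F]_n) x :
  pairing x (\sum_(i | P i) f i) = \sum_(i | P i) pairing x (f i).
Proof. by rewrite /pairing mulmx_sumr summxE. Qed.

Lemma pairing_mulmx x (A : 'M[F]_n) u : pairing (x *m A) u = pairing x (A *m u).
Proof. by rewrite /pairing mulmxA. Qed.

Lemma pairing_trmx x u : pairing u^T x^T = pairing x u.
Proof. by rewrite /pairing -trmx_mul mxE. Qed.

Lemma refl_mulr (a : 'rV[F]_n) (av : 'cV[F]_n) x :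
  x *m (1%:M - av *m a) = x - pairing x av *: a.
Proof. by rewrite mulmxBr mulmx1 mulmxA pairing_mul mul_scalar_mx. Qed.

Lemma refl_mull (a : 'rV[F]_n) (av : 'cV[F]_n) u :
  (1%:M - av *m a) *m u = u - pairing a u *: av.
Proof.
by rewrite mulmxBl mul1mx -mulmxA pairing_mul mul_mx_scalar.
Qed.

End Pairing.

(** A reflection sends its coroot to the opposite, so invariance gives
    [M(av, v) = M(- av, v - <a, v> av)], and the terms in [v] add up. *)
Lemma invariant_form_coroot (F : fieldType) (n : nat)
    (M : 'M[F]_n) (a : 'rV[F]_n) (av : 'cV[F]_n) :
    pairing a av = 2 ->
    (1%:M - av *m a)^T *m M *m (1%:M - av *m a) = M ->
  2 *: (av^T *m M) = bform M av av *: a.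
Proof.
move=> a2 sM.
have sav : (1%:M - av *m a) *m av = - av.
  by rewrite refl_mull a2 scaler_nat mulr2n opprD addNKr.
have := congr1 (mulmx av^T) sM; rewrite !mulmxA -trmx_mul sav linearN /=.
rewrite !mulNmx refl_mulr opprB -[pairing _ _]/(bform M av av) => /eqP.
by rewrite subr_eq -mulr2n -scaler_nat => /eqP.
Qed.

Section Forms.
Context (F : fieldType) (n : nat).
Implicit Types (M N : 'M[F]_n) (u v : 'cV[F]_n).

Lemma bformE M u v : bform M u v = pairing (bform_iso M u) v.
Proof. by []. Qed.

Lemma bform_mul M (A : 'M[F]_n) u v :
  bform M (A *m u) (A *m v) = bform (A^T *m M *m A) u v.
Proof. by rewrite /bform trmx_mul !mulmxA. Qed.

Lemma bform_trmx M u v : bform M^T u v = bform M v u.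
Proof.
rewrite /bform; have -> : u^T *m M^T *m v = (v^T *m M *m u)^T.
  by rewrite !trmx_mul trmxK mulmxA.
by rewrite mxE.
Qed.

Lemma bform_inj M N : (forall u v, bform M u v = bform N u v) -> M = N.
Proof.
move=> MN; apply/matrixP => i j.
have entry (P : 'M[F]_n) : bform P (delta_mx i 0) (delta_mx j 0) = P i j.
  by rewrite /bform trmx_delta -rowE -colE !mxE.
by rewrite -!entry MN.
Qed.

Lemma bform_gram (I : finType) (x : I -> 'rV[F]_n) u v :
  bform (\sum_i (x i)^T *m x i) u v = \sum_i pairing (x i) u * pairing (x i) v.
Proof.
rewrite /bform mulmx_sumr mulmx_suml summxE; apply: eq_bigr => i _.
rewrite mulmxA -mulmxA (pairing_mul (x i)) mul_mx_scalar mxE mulrC; congr (_ * _).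
by rewrite -[LHS]/(pairing _ _) pairing_trmx.
Qed.

End Forms.

Lemma cplx_mul (R : realType) m n p (A : 'M[R]_(m, n)) (D : 'M[R]_(n, p)) :
  cplx (A *m D) = cplx A *m cplx D.
Proof. exact: map_mxM. Qed.

Lemma cplx_pairing (R : realType) n (x : 'rV[R]_n) (u : 'cV[R]_n) :
  pairing (cplx x) (cplx u) = real_complex R (pairing x u).
Proof. by rewrite /pairing /cplx -map_mxM mxE. Qed.

(** * Roots, coroots and reflections *)

Section RootSystem.
Context (R : realType) (n : nat) (Phi : root_system R n).
Local Notation root := (root_set Phi).
Local Notation "c ^v" := (coroot Phi (val c)) (at level 2, format "c ^v").
Implicit Types a b c : root.

Definition root_reflect a b : root := [` roots_refl (valP a) (valP b)]%fset.

Lemma val_root_reflect a b : val (root_reflect a b) = val b *m refl Phi (val a).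
Proof. by rewrite refl_mulr. Qed.

Lemma pairing_root a : pairing (val a) a^v = 2.
Proof. exact/pairing_coroot/valP. Qed.

Lemma root_neq0 a : val a != 0.
Proof. by apply: contraNneq (roots_neq0 Phi) => <-; apply: valP. Qed.

Lemma refl_coroot a : refl Phi (val a) *m a^v = - a^v.
Proof. by rewrite refl_mull pairing_root scaler_nat mulr2n opprD addNKr. Qed.

Lemma refl_root a : val a *m refl Phi (val a) = - val a.
Proof. by rewrite refl_mulr pairing_root scaler_nat mulr2n opprD addNKr. Qed.

Lemma reflK a : refl Phi (val a) *m refl Phi (val a) = 1%:M.
Proof.
by rewrite {1}/refl mulmxBl mul1mx -mulmxA refl_root mulmxN opprK addrNK.
Qed.

Lemma root_reflectK a : involutive (root_reflect a).
Proof.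
by move=> b; apply: val_inj; rewrite !val_root_reflect -mulmxA reflK mulmx1.
Qed.

Lemma sum_root_reflect (V : nmodType) a (P : pred root) (F : root -> V) :
    (forall c, P (root_reflect a c) = P c) ->
  \sum_(c | P c) F c = \sum_(c | P c) F (root_reflect a c).
Proof.
move=> Pa; rewrite (reindex_inj (inv_inj (root_reflectK a))).
by apply: eq_bigl => c; apply: Pa.
Qed.

Definition root_opp a : root := root_reflect a a.

Lemma val_root_opp a : val (root_opp a) = - val a.
Proof. by rewrite val_root_reflect refl_root. Qed.

Lemma root_oppK : involutive root_opp.
Proof. by move=> a; apply: val_inj; rewrite !val_root_opp opprK. Qed.

Lemma pairing_int a b : exists z : int, pairing (val b) a^v = z%:~R.
Proof. exact/intrP/roots_crystallographic/valP/valP. Qed.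

(** From [s_a = s_b], evaluation at [a] gives [2 a = <a, b^vee> b]: the roots are
    proportional, and the root system is reduced. *)
Lemma refl_inj a b : refl Phi (val a) = refl Phi (val b) ->
  val a = val b \/ val a = - val b.
Proof.
move/(congr1 (mulmx (val a))); rewrite refl_root refl_mulr => /eqP.
rewrite eq_sym subr_eq eq_sym addrC subr_eq -mulr2n -scaler_nat => /eqP e.
have {}e : val a = (2^-1 * pairing (val a) b^v) *: val b.
  by rewrite -scalerA e scalerA mulVf ?scale1r // pnatr_eq0.
have ka : (2^-1 * pairing (val a) b^v) *: val b \in root by rewrite -e; apply: valP.
have [k1|kN1] := roots_reduced (valP b) ka.
  by left; rewrite e k1 scale1r.
by right; rewrite e kN1 scaleN1r.
Qed.

(** The canonical invariant form [sum_c <c, u> <c, v>] over all roots.  It is real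
    and positive definite, so it gives lengths of coroots whose sign is known;
    the form [B] of the theorem is only a complex form. *)
Definition root_gram : 'M[R]_n := \sum_(c : root) (val c)^T *m val c.

Lemma bform_root_gram u v :
  bform root_gram u v = \sum_(c : root) pairing (val c) u * pairing (val c) v.
Proof. exact: bform_gram. Qed.

Lemma root_gram_refl a :
  (refl Phi (val a))^T *m root_gram *m refl Phi (val a) = root_gram.
Proof.
rewrite mulmx_sumr mulmx_suml [RHS](sum_root_reflect (a := a)) //.
by apply: eq_bigr => c _; rewrite val_root_reflect trmx_mul !mulmxA.
Qed.

Lemma root_gram_sym : root_gram^T = root_gram.
Proof.
rewrite /root_gram linear_sum; apply: eq_bigr => c _ /=.
by rewrite trmx_mul trmxK.
Qed.

Lemma root_gram_coroot_gt0 a : 0 < bform root_gram a^v a^v.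
Proof.
rewrite bform_root_gram (bigD1 a) //= ltr_pwDl //.
  by rewrite pairing_root mulr_gt0 ?ltr0n.
by apply: sumr_ge0 => c _; rewrite -expr2 sqr_ge0.
Qed.

Lemma root_gram_coroot a :
  2 *: (a^v^T *m root_gram) = bform root_gram a^v a^v *: val a.
Proof. exact: invariant_form_coroot (pairing_root a) (root_gram_refl a). Qed.

Lemma pairing_coroot_sym a b :
  bform root_gram a^v a^v * pairing (val a) b^v =
  bform root_gram b^v b^v * pairing (val b) a^v.
Proof.
rewrite -!pairingZl -!root_gram_coroot !pairingZl; congr (_ * _).
by rewrite -[LHS]/(bform root_gram _ _) -[RHS]/(bform root_gram _ _)
  !bform_root_gram; apply: eq_bigr => c _; rewrite mulrC.
Qed.

(** Both numbers are positive multiples of the canonical form at [a^vee] and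
    [b^vee]. *)
Lemma pairing_coroot_ge0 a b :
  (0 <= pairing (val a) b^v) = (0 <= pairing (val b) a^v).
Proof.
rewrite -(pmulr_rge0 _ (root_gram_coroot_gt0 a)) pairing_coroot_sym.
by rewrite pmulr_rge0 // root_gram_coroot_gt0.
Qed.

(** The roots span over [R], hence also after extension of scalars along [f]. *)
Lemma roots_separating (F : nzRingType) (f : {rmorphism R -> F}) m
    (A : 'M[F]_(n, m)) :
  (forall c, map_mx f (val c) *m A = 0) -> A = 0.
Proof.
move=> cA; apply/row_matrixP => i; rewrite row0 rowE -(map_delta_mx f).
have : delta_mx 0 i \in <<enum_fset root>>%VS by rewrite roots_span memvf.
move=> /(@coord_span _ _ _ (in_tuple (enum_fset root))) ->.
rewrite raddf_sum mulmx_suml big1 // => k _ /=; rewrite map_mxZ -scalemxAl.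
have ck : (in_tuple (enum_fset root))`_k \in root by apply: mem_nth.
by rewrite (cA [` ck]%fset) scaler0.
Qed.

Lemma root_gram_inj (u v : 'cV[R]_n) :
  u^T *m root_gram = v^T *m root_gram -> u = v.
Proof.
move=> /eqP; rewrite -subr_eq0 -mulmxBl => /eqP uv0; apply/eqP.
rewrite -subr_eq0; apply/eqP/(roots_separating (f := idfun)) => c.
rewrite map_mx_id // pairing_mul.
have: bform root_gram (u - v) (u - v) = 0.
  by rewrite /bform [(u - v)^T]raddfB /= uv0 mul0mx mxE.
rewrite bform_root_gram => /eqP; rewrite psumr_eq0; last first.
  by move=> d _; rewrite -expr2 sqr_ge0.
move=> /allP/(_ c (mem_index_enum c)) /=; rewrite mulf_eq0 orbb => /eqP ->.
by rewrite raddf0.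
Qed.

(** A root is proportional to the canonical form at its coroot, and the form is
    injective, so the line of the coroot is determined by the root; the value
    2 of the pairing fixes the scale. *)
Lemma coroot_unique a (u : 'cV[R]_n) (k : R) :
  u^T *m root_gram = k *: val a -> pairing (val a) u = 2 -> u = a^v.
Proof.
move=> uk au; have q0 := lt0r_neq0 (root_gram_coroot_gt0 a).
set q := bform _ _ _ in q0.
have e : u = (k * q^-1 * 2) *: a^v.
  apply: root_gram_inj; rewrite linearZ /= -scalemxAl -scalerA.
  by rewrite root_gram_coroot scalerA -mulrA mulVf // mulr1.
have k1 : k * q^-1 * 2 = 1.
  apply: (@mulIf _ 2); rewrite ?pnatr_eq0 // mul1r -[in RHS]au [in RHS]e.
  by rewrite pairingZr pairing_root.
by rewrite e k1 scale1r.
Qed.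

(** By invariance of the canonical form, [s_a b^vee] corresponds to a multiple of
    [s_a b], and it pairs with it as [b^vee] does with [b]. *)
Lemma coroot_reflect a b :
  (root_reflect a b)^v = refl Phi (val a) *m b^v.
Proof.
symmetry; apply: (@coroot_unique _ _ (bform root_gram b^v b^v / 2)).
  rewrite trmx_mul -[_ *m root_gram]mulmxA.
  have -> : (refl Phi (val a))^T *m root_gram = root_gram *m refl Phi (val a).
    by rewrite -{2}(root_gram_refl a) -[RHS]mulmxA reflK mulmx1.
  rewrite mulmxA val_root_reflect scalemxAl mulrC -scalerA -root_gram_coroot.
  by rewrite scalerA mulVf ?scale1r // pnatr_eq0.
rewrite val_root_reflect -pairing_mulmx -mulmxA reflK mulmx1.
exact: pairing_root.
Qed.

Lemma coroot_opp a : (root_opp a)^v = - a^v.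
Proof. by rewrite coroot_reflect refl_coroot. Qed.

Lemma refl_opp a : refl Phi (val (root_opp a)) = refl Phi (val a).
Proof. by rewrite /refl coroot_opp val_root_opp mulmxN mulNmx opprK. Qed.

Lemma refl_reflect a b :
  refl Phi (val (root_reflect a b)) =
    refl Phi (val a) *m refl Phi (val b) *m refl Phi (val a).
Proof.
rewrite [LHS]/refl coroot_reflect val_root_reflect [refl Phi (val b)]/refl.
move: (refl Phi (val a)) (reflK a) => s sK.
by rewrite mulmxBr mulmxBl mulmx1 sK !mulmxA.
Qed.

(** [s_a b = b - m a] with [m] an integer stays in the integral span. *)
Lemma root_subsystem_reflect Psi a b : root_subsystem Phi Psi ->
    val a \in Psi ->
  (val (root_reflect a b) \in Psi) = (val b \in Psi).
Proof.
move=> Psi_sub a_Psi.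
have stable c : val c \in Psi -> val (root_reflect a c) \in Psi.
  move=> c_Psi; apply/Psi_sub; split; last exact: valP.
  have [[ka aE] _] := (Psi_sub _).1 a_Psi.
  have [[kc cE] _] := (Psi_sub _).1 c_Psi.
  have [m cm] := pairing_int a c.
  exists (fun x => kc x - ka x * m); rewrite [LHS]/= cm scaler_int {1}cE {1}aE.
  rewrite mulrz_suml -sumrB; apply: eq_bigr => x _.
  by rewrite mulrzBr mulrzA.
by apply/idP/idP => /stable //; rewrite root_reflectK.
Qed.

Lemma root_subsystem_opp Psi a : root_subsystem Phi Psi ->
  (val (root_opp a) \in Psi) = (val a \in Psi).
Proof.
move=> Psi_sub.
have stable c : val c \in Psi -> val (root_opp c) \in Psi.
  by move=> c_Psi; rewrite (root_subsystem_reflect _ Psi_sub).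
by apply/idP/idP => /stable //; rewrite root_oppK.
Qed.

End RootSystem.

(** * Positive roots and the dual Coxeter number *)

Section PositiveRoots.
Context (R : realType) (n : nat) (Phi : root_system R n).
Context (Delta : simple_system Phi).
Local Notation root := (root_set Phi).
Local Notation "c ^v" := (coroot Phi (val c)) (at level 2, format "c ^v").
Local Notation pos c := (val c \in pos_roots Delta).
Implicit Types a b c : root.

Definition simple_coord (i : 'I_n) (v : 'rV[R]_n) : R :=
  coord [tuple simple Delta i | i < n] i v.

Lemma simple_coord_comb (k : 'I_n -> R) j :
  simple_coord j (\sum_(i < n) k i *: Delta i) = k j.
Proof.
rewrite /simple_coord -[RHS](coord_sum_free k j (basis_free (simple_basis Delta))).
by congr (coord _ _ _); apply: eq_bigr => i _; rewrite -tnth_nth tnth_mktuple.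
Qed.

Lemma simple_coordE v : v = \sum_(i < n) simple_coord i v *: Delta i.
Proof.
rewrite {1}(coord_basis (simple_basis Delta) (memvf v)); apply: eq_bigr => i _.
by rewrite -tnth_nth tnth_mktuple.
Qed.

Lemma simple_coordB i u v :
  simple_coord i (u - v) = simple_coord i u - simple_coord i v.
Proof. exact: raddfB. Qed.

Lemma simple_coordN i v : simple_coord i (- v) = - simple_coord i v.
Proof. exact: raddfN. Qed.

Lemma simple_coordZ i k v : simple_coord i (k *: v) = k * simple_coord i v.
Proof. exact: linearZ. Qed.

Lemma simple_coord_simple i j : simple_coord i (Delta j) = (i == j)%:R.
Proof.
rewrite -[RHS](simple_coord_comb (fun l => (l == j)%:R)) (bigD1 j) //=.
rewrite eqxx scale1r big1 ?addr0 // => l /negPf ->; exact: scale0r.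
Qed.

Lemma simple_coord_ge0 v i : nonneg_comb Delta v -> 0 <= simple_coord i v.
Proof.
move=> [k ->]; under eq_bigr => l _ do rewrite -scaler_nat.
by rewrite simple_coord_comb ler0n.
Qed.

Lemma pos_rootP c : reflect (nonneg_comb Delta (val c)) (pos c).
Proof.
by rewrite /pos_roots !inE (valP c); apply: asboolP.
Qed.

Lemma pos_rootE c : pos c = [forall i, 0 <= simple_coord i (val c)].
Proof.
apply/pos_rootP/forallP => [+ i|c_ge0].
  exact: simple_coord_ge0.
have [//|[k ck]] := simple_sign Delta (valP c).
have cN : nonneg_comb Delta (- val c) by exists k; rewrite ck opprK.
case/eqP: (root_neq0 c); rewrite (simple_coordE (val c)) big1 // => i _.
have := simple_coord_ge0 i cN; rewrite simple_coordN oppr_ge0 => c_le0.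
by rewrite (le_anti (introT andP (conj c_le0 (c_ge0 i)))) scale0r.
Qed.

Lemma pos_coord_ge0 c i : pos c -> 0 <= simple_coord i (val c).
Proof. by rewrite pos_rootE => /forallP. Qed.

Lemma pos_coord_gt0 c : pos c -> exists i, 0 < simple_coord i (val c).
Proof.
move=> c_pos; apply/existsP; apply: contraNT (root_neq0 c) => /existsPn c_le0.
rewrite (simple_coordE (val c)) big1 // => i _.
have := c_le0 i; rewrite -leNgt => ci_le0.
by rewrite (le_anti (introT andP (conj ci_le0 (pos_coord_ge0 i c_pos)))) scale0r.
Qed.

Lemma pos_root_opp c : pos (root_opp c) = ~~ pos c.
Proof.
apply/idP/idP => [Nc_pos|].
  apply/negP => c_pos; have [i +] := pos_coord_gt0 c_pos.
  by rewrite ltNge -oppr_ge0 -simple_coordN -val_root_opp pos_coord_ge0.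
move=> /pos_rootP c_npos; apply/pos_rootP; rewrite val_root_opp.
by have [//|[k ->]] := simple_sign Delta (valP c); exists k; rewrite opprK.
Qed.

Lemma sum_roots_pos (V : nmodType) (P : pred root) (F : root -> V) :
    (forall c, P (root_opp c) = P c) -> (forall c, F (root_opp c) = F c) ->
  \sum_(c | P c) F c = (\sum_(c | P c && pos c) F c) *+ 2.
Proof.
move=> PN FN; rewrite (bigID (fun c => pos c)) mulr2n /=; congr (_ + _).
rewrite (reindex_inj (inv_inj (@root_oppK _ _ Phi))).
by apply: eq_big => c; rewrite ?PN ?pos_root_opp ?negbK // FN.
Qed.

Definition simple_root_of i : root := [` simple_root Delta i]%fset.

(** The reflection in the simple root [i] changes only the [i]-th coordinate.  A
    positive root that is sent to a negative one has all other coordinates equal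
    to 0, so it is a multiple of the simple root. *)
Lemma simple_reflect_pos i c : pos c -> val c != Delta i ->
  pos (root_reflect (simple_root_of i) c).
Proof.
move=> c_pos; apply: contraNT; rewrite -pos_root_opp => sc_neg.
have c_coord j : j != i -> simple_coord j (val c) = 0.
  move=> ji; have := pos_coord_ge0 j sc_neg.
  rewrite val_root_opp simple_coordN simple_coordB simple_coordZ.
  rewrite simple_coord_simple (negPf ji) mulr0 subr0 oppr_ge0 => c_le0.
  exact: le_anti (introT andP (conj c_le0 (pos_coord_ge0 j c_pos))).
have ci : val c = simple_coord i (val c) *: Delta i.
  rewrite {1}(simple_coordE (val c)) (bigD1 i) //= big1 ?addr0 // => j ji.
  by rewrite c_coord // scale0r.
have ciP : simple_coord i (val c) *: Delta i \in root by rewrite -ci; apply: valP.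
have [k1|kN1] := roots_reduced (simple_root Delta i) ciP.
  by rewrite ci k1 scale1r.
by have := pos_coord_ge0 i c_pos; rewrite kN1 oppr_ge0 ler10.
Qed.

(** The simple reflection permutes the other positive roots and changes the sign
    of their pairing with the simple coroot, so that only the simple root itself
    contributes. *)
Lemma sum_pos_simple_coroot i :
  \sum_(c : root | pos c) pairing (val c) (coroot Phi (Delta i)) = 2.
Proof.
set d := simple_root_of i; have d_pos : pos d.
  by rewrite pos_rootE; apply/forallP => j; rewrite simple_coord_simple ler0n.
rewrite (bigD1 d) //= (pairing_root d) -[RHS]addr0; congr (_ + _).
set S := (X in X = 0).
have S_opp : S = - S.
  rewrite {1}/S (sum_root_reflect (a := d)) => [|c].
    rewrite -sumrN; apply: eq_bigr => c _.
    by rewrite val_root_reflect pairing_mulmx refl_coroot pairingNr.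
  have stable b : pos b && (b != d) ->
      pos (root_reflect d b) && (root_reflect d b != d).
    move=> /andP[b_pos bd]; rewrite simple_reflect_pos //=.
    apply: contraTneq b_pos => sb; rewrite -(root_reflectK d b) sb.
    by rewrite -[root_reflect d d]/(root_opp d) pos_root_opp d_pos.
  by apply/idP/idP => /stable //; rewrite root_reflectK.
have : S *+ 2 == 0 by rewrite mulr2n {1}S_opp addNr.
by rewrite mulrn_eq0 => /eqP.
Qed.

(** Put [m = <c, theta^vee>].  It is nonnegative because
    [theta - s_c theta = <theta, c^vee> c] has nonnegative coordinates.  If
    [m >= 2], then the root [- s_theta c = m theta - c] lies below [theta], so
    [(m - 1) theta <= c <= theta] coordinatewise, which forces [c = theta]. *)
Lemma pairing_highest_coroot (t : root) c : highest_root Delta (val t) ->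
    pos c -> c != t ->
  pairing (val c) t^v = 0 \/ pairing (val c) t^v = 1.
Proof.
move=> [_ t_max] c_pos ct.
have coord_le (b : root) i : simple_coord i (val b) <= simple_coord i (val t).
  by rewrite -subr_ge0 -simple_coordB; apply/simple_coord_ge0/t_max/valP.
have tc_ge0 : 0 <= pairing (val t) c^v.
  have [i ci] := pos_coord_gt0 c_pos.
  have := coord_le (root_reflect c t) i.
  rewrite simple_coordB simple_coordZ gerBl.
  by rewrite pmulr_lge0.
have [m ctm] := pairing_int t c.
have : 0 <= pairing (val c) t^v by rewrite pairing_coroot_ge0.
rewrite ctm ler0z; case: m ctm => [[|[|m]]|//] ctm _; [by left|by right|].
case/eqP: ct; apply: val_inj; rewrite (simple_coordE (val c)).
rewrite [RHS]simple_coordE; apply: eq_bigr => i _; congr (_ *: _).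
apply: le_anti; rewrite coord_le /=.
have := coord_le (root_opp (root_reflect t c)) i.
have t_ge0 : 0 <= simple_coord i (val t).
  exact: le_trans (pos_coord_ge0 i c_pos) (coord_le c i).
rewrite val_root_opp simple_coordN simple_coordB simple_coordZ ctm opprB.
rewrite lerBlDr; have m2 : 2 <= m.+2%:~R :> R by rewrite (ler_nat R 2 m.+2).
move/(le_trans (ler_wpM2r t_ge0 m2)).
by rewrite mulr_natl mulr2n lerD2l.
Qed.

(** The square of a pairing is the pairing itself except at [theta], where it is
    4 instead of 2. *)
Lemma sum_sqr_pairing_highest_coroot (t : root) (g : 'I_n -> R) :
    highest_root Delta (val t) -> t^v = \sum_(i < n) g i *: coroot Phi (Delta i) ->
  \sum_(c : root | pos c) pairing (val c) t^v * pairing (val c) t^v =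
    (1 + \sum_(i < n) g i) *+ 2.
Proof.
move=> t_max tg; have t_pos : pos t.
  rewrite -[pos t]negbK -pos_root_opp; apply/negP => Nt_pos.
  have [i +] := pos_coord_gt0 Nt_pos; apply/negP; rewrite -leNgt.
  have := simple_coord_ge0 i (t_max.2 _ (valP (root_opp t))).
  rewrite val_root_opp simple_coordB simple_coordN opprK -mulr2n.
  by rewrite pmulrn_lge0 // oppr_le0.
have sum_pairing : \sum_(c : root | pos c) pairing (val c) t^v =
    (\sum_(i < n) g i) *+ 2.
  under eq_bigr => c _ do rewrite tg pairing_sumr.
  rewrite exchange_big -sumrMnl; apply: eq_bigr => i _ /=.
  under eq_bigr => c _ do rewrite pairingZr.
  by rewrite -mulr_sumr sum_pos_simple_coroot mulr_natr.
rewrite mulrnDl -sum_pairing !(bigD1 t t_pos) /= pairing_root addrA; congr (_ + _).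
  by rewrite -natrM -natrD.
apply: eq_bigr => c /andP[c_pos ct].
by have [->|->] := pairing_highest_coroot t_max c_pos ct; rewrite ?mul0r ?mul1r.
Qed.

Lemma root_gram_highest_coroot (t : root) (g : 'I_n -> R) :
    highest_root Delta (val t) -> t^v = \sum_(i < n) g i *: coroot Phi (Delta i) ->
  bform (root_gram Phi) t^v t^v = (1 + \sum_(i < n) g i) *+ 4.
Proof.
move=> t_max tg; rewrite bform_root_gram sum_roots_pos //.
  by rewrite (sum_sqr_pairing_highest_coroot t_max tg) -mulrnA.
by move=> c; rewrite val_root_opp !pairingNl mulrNN.
Qed.

End PositiveRoots.

(** * Invariant forms of an irreducible root system *)

Section InvariantForms.
Context (R : realType) (n : nat) (Phi : root_system R n).
Local Notation root := (root_set Phi).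
Local Notation "c ^v" := (coroot Phi (val c)) (at level 2, format "c ^v").
Local Notation C := R[i].
Implicit Types a b c : root.

Definition refl_invariant (M : 'M[C]_n) : Prop :=
  forall a, (cplx (refl Phi (val a)))^T *m M *m cplx (refl Phi (val a)) = M.

Lemma cplx_refl a : cplx (refl Phi (val a)) = 1%:M - cplx a^v *m cplx (val a).
Proof. by rewrite /refl /cplx map_mxB map_mx1 map_mxM. Qed.

Lemma refl_invariant_coroot (M : 'M[C]_n) a : refl_invariant M ->
  2 *: ((cplx a^v)^T *m M) = bform M (cplx a^v) (cplx a^v) *: cplx (val a).
Proof.
move=> M_inv; apply: invariant_form_coroot.
  by rewrite cplx_pairing pairing_root rmorph_nat.
by rewrite -cplx_refl M_inv.
Qed.

Lemma refl_invariant_bform (M : 'M[C]_n) a v : refl_invariant M ->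
  2 * bform M (cplx a^v) v =
    bform M (cplx a^v) (cplx a^v) * pairing (cplx (val a)) v.
Proof.
by move=> M_inv; rewrite bformE -pairingZl refl_invariant_coroot // pairingZl.
Qed.

Lemma refl_invariant_bform_neq0 (B : 'M[C]_n) a :
  B \in unitmx -> refl_invariant B -> bform B (cplx a^v) (cplx a^v) != 0.
Proof.
move=> B_unit B_inv; apply/eqP => Ba0.
have := refl_invariant_coroot a B_inv; rewrite Ba0 scale0r => /eqP.
rewrite scaler_eq0 pnatr_eq0 /= => /eqP/(congr1 (mulmx^~ (invmx B))).
rewrite mulmxK // mul0mx => /(congr1 trmx); rewrite trmxK trmx0 => av0.
have := congr1 (real_complex R) (pairing_root a).
rewrite -cplx_pairing av0 rmorph_nat /pairing mulmx0 mxE => /eqP.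
by rewrite eq_sym pnatr_eq0.
Qed.

Lemma refl_invariant_root_gram : refl_invariant (cplx (root_gram Phi)).
Proof. by move=> a; rewrite /cplx map_trmx -!map_mxM root_gram_refl. Qed.

(** An elementary Schur lemma: on each coroot [M] is a multiple of [B], the factor
    is the same for two roots that are not orthogonal, so the roots with a given
    factor form a union of components. *)
Lemma invariant_form_unique (B M : 'M[C]_n) :
    irreducible_root_system Phi -> B \in unitmx -> B^T = B -> M^T = M ->
    refl_invariant B -> refl_invariant M ->
  exists k, M = k *: B.
Proof.
move=> [/fset0Pn[t t_root] irr] B_unit B_sym M_sym B_inv M_inv.
pose ratio (x : 'rV[R]_n) := bform M (cplx (coroot Phi x)) (cplx (coroot Phi x)) /
  bform B (cplx (coroot Phi x)) (cplx (coroot Phi x)).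
have ratioP a : (cplx a^v)^T *m M = ratio (val a) *: ((cplx a^v)^T *m B).
  apply: (scalerI (_ : 2 != 0 :> C)); first by rewrite pnatr_eq0.
  rewrite refl_invariant_coroot // scalerA mulrC -scalerA refl_invariant_coroot //.
  by rewrite scalerA /ratio divfK // refl_invariant_bform_neq0.
(* [M(a^vee, b^vee)] computed from either side, when [B(a^vee, b^vee) <> 0]. *)
have ratio_eq a b : pairing (val a) b^v != 0 -> ratio (val a) = ratio (val b).
  move=> ab0; have Bab0 : bform B (cplx a^v) (cplx b^v) != 0.
    apply: contraNneq ab0 => Bab0; have := refl_invariant_bform a (cplx b^v) B_inv.
    rewrite Bab0 mulr0 => /esym/eqP; rewrite mulf_eq0.
    rewrite (negPf (refl_invariant_bform_neq0 _ B_unit B_inv)) cplx_pairing.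
    by rewrite fmorph_eq0.
  apply: (mulIf Bab0); rewrite -[in RHS]B_sym bform_trmx !bformE -!pairingZl.
  by rewrite -!ratioP -[LHS]/(bform M _ _) -[in LHS]M_sym bform_trmx.
pose A := [fset x in root_set Phi | ratio x == ratio t]%fset.
have A_all : A = root_set Phi.
  apply: irr.
  - by apply/fsubsetP => x; rewrite !inE => /andP[].
  - by apply/fset0Pn; exists t; rewrite !inE t_root eqxx.
  - move=> x y; rewrite !inE => /andP[xr /eqP xt] /andP[yA yr].
    apply/eqP; apply: contraNT yA => yx0; rewrite yr /= -xt.
    by rewrite (ratio_eq [` yr]%fset [` xr]%fset).
have ratio_const a : ratio (val a) = ratio t.
  have: val a \in A by rewrite A_all; apply: valP.
  by rewrite !inE => /andP[_ /eqP].
exists (ratio t); apply/eqP; rewrite -subr_eq0; apply/eqP.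
suff X0 : invmx B *m (M - ratio t *: B) = 0.
  by rewrite -[LHS](mulKVmx B_unit) X0 mulmx0.
apply: (roots_separating (f := real_complex R)) => a; rewrite -/(cplx (val a)).
apply: (scalerI (refl_invariant_bform_neq0 a B_unit B_inv)).
rewrite scaler0 scalemxAl -refl_invariant_coroot // -scalemxAl mulmxA mulmxK //.
by rewrite mulmxBr ratioP ratio_const -scalemxAr subrr scaler0.
Qed.

Context (Delta : simple_system Phi).
Local Notation pos c := (val c \in pos_roots Delta).

(** By uniqueness of invariant forms the canonical form is a multiple of [B]; the
    factor is read off at [theta^vee], where the values are [4 h] and 2. *)
Lemma sum_pos_roots_bform (B : 'M[C]_n) (t : root) (g : 'I_n -> R) u v :
    irreducible_root_system Phi -> B \in unitmx -> B^T = B -> refl_invariant B ->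
    highest_root Delta (val t) -> t^v = \sum_(i < n) g i *: coroot Phi (Delta i) ->
    bform B (cplx t^v) (cplx t^v) = 2 ->
  \sum_(c : root | pos c) pairing (cplx (val c)) u * pairing (cplx (val c)) v =
    real_complex R (1 + \sum_(i < n) g i) * bform B u v.
Proof.
move=> irr B_unit B_sym B_inv t_max tg t_norm.
have gram_sym : (cplx (root_gram Phi))^T = cplx (root_gram Phi).
  by rewrite /cplx map_trmx root_gram_sym.
have [k gramE] := invariant_form_unique irr B_unit B_sym gram_sym B_inv
  refl_invariant_root_gram.
have bformZ x y : bform (k *: B) x y = k * bform B x y.
  by rewrite /bform -scalemxAr -scalemxAl mxE.
have kE : k = real_complex R (1 + \sum_(i < n) g i) *+ 2.
  apply: (mulIf (_ : 2 != 0 :> C)); first by rewrite pnatr_eq0.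
  have gram4 := congr1 (real_complex R) (root_gram_highest_coroot t_max tg).
  rewrite raddfMn in gram4; rewrite [RHS]mulr_natr -mulrnA -gram4.
  rewrite -[X in k * X]t_norm -bformZ -gramE.
  by rewrite /bform /cplx map_trmx -!map_mxM mxE.
apply: (mulIf (_ : 2 != 0 :> C)); first by rewrite pnatr_eq0.
rewrite mulr_natr.
rewrite -(@sum_roots_pos _ _ _ Delta _ predT (fun c =>
  pairing (cplx (val c)) u * pairing (cplx (val c)) v)) //; last first.
  by move=> c; rewrite val_root_opp /cplx map_mxN !pairingNl mulrNN.
rewrite -bform_gram mulrAC mulr_natr -kE -bformZ -gramE; congr bform.
rewrite /cplx raddf_sum; apply: eq_bigr => c _ /=.
by rewrite map_mxM map_trmx.
Qed.

(** Under the identification given by [B], the root [a] is half of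
    [B(a^vee, a^vee)] times its coroot. *)
Lemma bform_dual_root (B : 'M[C]_n) a : B \in unitmx -> refl_invariant B ->
  2 / bform_dual B (cplx (val a)) (cplx (val a)) =
    bform B (cplx a^v) (cplx a^v) / 2.
Proof.
move=> B_unit B_inv; have B0 := refl_invariant_bform_neq0 a B_unit B_inv.
set k := bform B _ _ in B0 *.
have -> : bform_dual B (cplx (val a)) (cplx (val a)) = 4 / k.
  apply: (mulfI B0); rewrite mulrCA divff // mulr1.
  rewrite -[bform_dual _ _ _]/(pairing _ _) -pairingZl.
  rewrite scalemxAl -refl_invariant_coroot // -scalemxAl mulmxK // pairingZl.
  by rewrite pairing_trmx cplx_pairing pairing_root rmorph_nat -natrM.
rewrite invf_div mulrCA; congr (_ * _).
by rewrite -[4]/((2 * 2)%:R) natrM invfM mulrA divff ?mul1r // pnatr_eq0.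
Qed.

End InvariantForms.

(** * Relations in the rational Cherednik algebra *)

Lemma comm_scaler (K : comPzRingType) (A : algType K) (x y : A) k :
  GRing.comm x y -> GRing.comm x (k *: y).
Proof. by rewrite /GRing.comm -scalerAr -scalerAl => ->. Qed.

Section Cherednik.
Context (R : realType) (n : nat) (Phi : root_system R n) (Delta : simple_system Phi).
Local Notation root := (root_set Phi).
Local Notation "c ^v" := (coroot Phi (val c)) (at level 2, format "c ^v").
Local Notation pos c := (val c \in pos_roots Delta).
Local Notation C := R[i].
Local Notation H := (rca Delta).
Local Notation E := (@rca_rel R n Phi Delta).
Local Notation wrefl a := (rca_w Delta (reflection_weyl (root_reflection a))).
Local Notation crefl a := (rca_c Delta (root_reflection a)).
Implicit Types a b c : root.

Lemma rca_classD t1 t2 :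
  alg_class E (AAdd t1 t2) = (alg_class E t1 + alg_class E t2 : H).
Proof. exact/esym/pa_addE. Qed.

Lemma rca_classZ k t : alg_class E (AScale k t) = (k *: (alg_class E t : H) : H).
Proof. exact/esym/pa_scaleE. Qed.

Lemma rca_classM t1 t2 :
  alg_class E (AMul t1 t2) = (alg_class E t1 : H) * (alg_class E t2 : H) :> H.
Proof. exact/esym/pa_mulE. Qed.

Lemma rca_class_sum (I : finType) (F : I -> alg_term C (rca_gen Phi)) :
  alg_class E (\big[@AAdd _ _/AZero C (rca_gen Phi)]_i F i) =
    (\sum_i (alg_class E (F i) : H)) :> H.
Proof. exact: (big_morph (alg_class E : _ -> H) rca_classD). Qed.

Lemma rca_class_rel t1 t2 : E t1 t2 -> alg_class E t1 = alg_class E t2 :> H.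
Proof. by move=> t12; apply/alg_classP/alg_rel. Qed.

Lemma rca_w_mul w1 w2 w : sval w = sval w1 *m sval w2 ->
  rca_w Delta w1 * rca_w Delta w2 = rca_w Delta w.
Proof. by move=> w12; rewrite -rca_classM; apply/rca_class_rel/rca_wM. Qed.

Lemma rca_x_linear : linear (rca_x Delta).
Proof.
by move=> k x x'; rewrite -rca_classZ -rca_classD; apply/rca_class_rel/rca_xlin.
Qed.

Lemma rca_y_linear : linear (rca_y Delta).
Proof.
by move=> k y y'; rewrite -rca_classZ -rca_classD; apply/rca_class_rel/rca_ylin.
Qed.

Lemma rca_w_x w x :
  rca_w Delta w * rca_x Delta x =
    rca_x Delta (x *m invmx (cplx (sval w))) * rca_w Delta w.
Proof. by rewrite -!rca_classM; apply/rca_class_rel/rca_wx. Qed.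

Lemma rca_w_y w y :
  rca_w Delta w * rca_y Delta y =
    rca_y Delta (cplx (sval w) *m y) * rca_w Delta w.
Proof. by rewrite -!rca_classM; apply/rca_class_rel/rca_wy. Qed.

Lemma rca_hbar_comm g : GRing.comm (rca_hbar Delta) (alg_class E (AGen C g) : H).
Proof.
by rewrite /GRing.comm -!rca_classM; apply/rca_class_rel/rca_hbar_central.
Qed.

Lemma rca_c_comm s g : GRing.comm (rca_c Delta s) (alg_class E (AGen C g) : H).
Proof.
by rewrite /GRing.comm -!rca_classM; apply/rca_class_rel/rca_c_central.
Qed.

Lemma rca_c_reflect a b : crefl (root_reflect a b) = crefl b.
Proof.
apply/rca_class_rel/(rca_c_conj _ (w := reflection_weyl (root_reflection a))).
rewrite /= refl_reflect; congr (_ *m _).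
by rewrite -[LHS]mulmx1 -(mulmxV (mulmx1_unit (reflK a)).1) mulmxA reflK mul1mx.
Qed.

Lemma rca_w_reflect a b :
  wrefl a * wrefl b = wrefl (root_reflect a b) * wrefl a.
Proof.
have ab_weyl : in_weyl Phi (refl Phi (val a) *m refl Phi (val b)).
  apply: weylM; first exact: valP.
  exact: in_weyl_reflection (root_reflection b).
rewrite (rca_w_mul (w := exist _ _ ab_weyl)) //.
rewrite (rca_w_mul (w := exist _ _ ab_weyl)) //=.
by rewrite refl_reflect -mulmxA reflK mulmx1.
Qed.

Lemma rca_bracket_sub (t1 t2 : alg_term C (rca_gen Phi)) :
  bracket (alg_class E t1 : H) (alg_class E t2 : H) =
  alg_class E (AAdd (AMul t1 t2) (AScale (-1) (AMul t2 t1))).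
Proof. by rewrite rca_classD rca_classZ !rca_classM scaleN1r. Qed.

Lemma rca_bracket_x x x' : bracket (rca_x Delta x) (rca_x Delta x') = 0.
Proof. by rewrite rca_bracket_sub; apply/rca_class_rel/rca_xx. Qed.

Lemma rca_bracket_y y y' : bracket (rca_y Delta y) (rca_y Delta y') = 0.
Proof. by rewrite rca_bracket_sub; apply/rca_class_rel/rca_yy. Qed.

(** Of two opposite roots, which have the same reflection, one is positive: the
    list whose head defines [reflection_root] is not empty. *)
Lemma reflection_rootP (s : reflections Phi) :
  reflection_root Delta s \in pos_roots Delta /\
  refl Phi (reflection_root Delta s) = val s.
Proof.
have /imfsetP[x x_root sE] := valP s.
have [c c_pos cs] : exists2 c : root, pos c & refl Phi (val c) = val s.
  pose c : root := [` x_root]%fset.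
  have [c_pos|] := boolP (pos c); first by exists c.
  by rewrite -pos_root_opp => Nc_pos; exists (root_opp c); rewrite ?refl_opp.
rewrite /reflection_root; set l := filter _ _.
have : val c \in l by rewrite mem_filter cs eqxx.
case El: l => [//|y l'] _ /=.
have : y \in l by rewrite El mem_head.
by rewrite mem_filter => /andP[/eqP ys y_pos].
Qed.

Lemma pos_roots_root x : x \in pos_roots Delta -> x \in root.
Proof. by rewrite !inE => /andP[]. Qed.

Definition reflection_pos_root (s : reflections Phi) : root :=
  [` pos_roots_root (reflection_rootP s).1]%fset.

Lemma reflection_pos_rootK : cancel reflection_pos_root (@root_reflection _ _ Phi).
Proof. by move=> s; apply: val_inj; rewrite /= (reflection_rootP s).2. Qed.

Lemma root_reflectionK c : (reflection_pos_root (root_reflection c) == c) = pos c.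
Proof.
have [s_pos s_refl] := reflection_rootP (root_reflection c).
apply/eqP/idP => [<- //|c_pos]; apply: val_inj.
have [//|e] := @refl_inj _ _ _ (reflection_pos_root (root_reflection c)) c s_refl.
have : pos (reflection_pos_root (root_reflection c)) by [].
by rewrite e -val_root_opp pos_root_opp c_pos.
Qed.

(** The sum over reflections of the defining relation becomes the sum over
    positive roots that occurs in the elliptic holonomy relation. *)
Lemma rca_bracket_yx y x :
  bracket (rca_y Delta y) (rca_x Delta x) =
    pairing x y *: rca_hbar Delta -
    \sum_(c : root | pos c)
      (pairing (cplx (val c)) y * pairing x (cplx c^v)) *: (crefl c * wrefl c).
Proof.
rewrite rca_bracket_sub (rca_class_rel (rca_yx Delta y x)) rca_classD !rca_classZ.
rewrite scaleN1r rca_class_sum; congr (_ - _).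
rewrite (reindex_onto (@root_reflection _ _ Phi) reflection_pos_root) /=; last first.
  by move=> s _; apply: reflection_pos_rootK.
apply: eq_big => [c|c]; rewrite root_reflectionK // => c_pos.
rewrite rca_classZ rca_classM.
have -> // : reflection_root Delta (root_reflection c) = val c.
by rewrite -root_reflectionK in c_pos; rewrite -[in RHS](eqP c_pos).
Qed.

Context (B : 'M[C]_n) (B_unit : B \in unitmx) (B_inv : refl_invariant Phi B).

Definition reflection_term a : H :=
  (2 / bform_dual B (cplx (val a)) (cplx (val a))) *: (crefl a * wrefl a).

(** Conjugation by [s_a] takes [s_b] to [s_(s_a b)] and changes neither the length
    of the root nor the parameter, which depends on the conjugacy class only. *)
Lemma reflection_term_reflect a b :
  wrefl a * reflection_term b = reflection_term (root_reflect a b) * wrefl a.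
Proof.
rewrite /reflection_term -scalerAr -scalerAl !bform_dual_root //.
rewrite coroot_reflect !cplx_mul bform_mul B_inv.
congr (_ *: _); rewrite rca_c_reflect mulrA -(rca_c_comm _ (hgen_w _)).
by rewrite -!mulrA rca_w_reflect.
Qed.

Lemma reflection_term_opp a : reflection_term (root_opp a) = reflection_term a.
Proof.
rewrite /reflection_term !bform_dual_root // rca_c_reflect.
have -> : root_reflection (root_opp a) = root_reflection a.
  by apply: val_inj; apply: refl_opp.
by rewrite coroot_reflect !cplx_mul bform_mul B_inv.
Qed.

Lemma rca_bracket_comm (x y : H) : GRing.comm x y -> bracket x y = 0.
Proof. by move=> xy; apply/eqP; rewrite subr_eq0; apply/eqP. Qed.

Lemma rca_bracketZ k l (x y : H) :
  bracket (k *: x) (l *: y) = (k * l) *: bracket x y.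
Proof.
rewrite -[LHS]/(_ * _ - _ * _) -[bracket x y]/(x * y - y * x).
by rewrite scalerBr -!scalerAr -!scalerAl !scalerA [l * k]mulrC.
Qed.

Lemma cplx_reflK a :
  cplx (refl Phi (val a)) *m cplx (refl Phi (val a)) = 1%:M.
Proof. by rewrite -cplx_mul reflK /cplx map_mx1. Qed.

(** The reflection fixes [u], and therefore also its image under the isomorphism
    given by the invariant form. *)
Lemma wrefl_comm_x a u : pairing (cplx (val a)) u = 0 ->
  GRing.comm (wrefl a) (rca_x Delta (bform_iso B u)).
Proof.
move=> au; rewrite /GRing.comm rca_w_x /=; congr (rca_x _ _ * _).
have s_unit := (mulmx1_unit (cplx_reflK a)).1.
suff {1}<- : bform_iso B u *m cplx (refl Phi (val a)) = bform_iso B u.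
  by rewrite mulmxK.
have su : cplx (refl Phi (val a)) *m u = u.
  by rewrite cplx_refl refl_mull au scale0r subr0.
by rewrite /bform_iso -{1}su trmx_mul -[in RHS](B_inv a) !mulmxA.
Qed.

Lemma wrefl_comm_y a u : pairing (cplx (val a)) u = 0 ->
  GRing.comm (wrefl a) (rca_y Delta u).
Proof.
move=> au; rewrite /GRing.comm rca_w_y /=; congr (rca_y _ _ * _).
by rewrite cplx_refl refl_mull au scale0r subr0.
Qed.

Context (k : C).

(** For [k] the inverse of the dual Coxeter number and up to a scalar, the image
    of the generator [t_a].  A general [k] is allowed because the value of the
    dual Coxeter number matters only for the relation between [y] and [x]. *)
Definition cherednik_t a : H := k *: rca_hbar Delta - reflection_term a.

Lemma cherednik_t_opp a : cherednik_t (root_opp a) = cherednik_t a.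
Proof. by rewrite /cherednik_t reflection_term_opp. Qed.

Lemma cherednik_t_comm a (x : H) :
    GRing.comm (rca_hbar Delta) x -> GRing.comm (crefl a) x ->
    GRing.comm (wrefl a) x ->
  GRing.comm (cherednik_t a) x.
Proof.
move=> hx cx wx; apply/commr_sym/commrB; apply/comm_scaler; first exact/commr_sym.
by apply: commrM; apply/commr_sym.
Qed.

Lemma cherednik_t_comm_x a u : pairing (cplx (val a)) u = 0 ->
  GRing.comm (cherednik_t a) (rca_x Delta (bform_iso B u)).
Proof.
by move=> au; apply: cherednik_t_comm; [apply: rca_hbar_comm | apply: rca_c_comm
  | apply: wrefl_comm_x].
Qed.

Lemma cherednik_t_comm_y a u : pairing (cplx (val a)) u = 0 ->
  GRing.comm (cherednik_t a) (rca_y Delta u).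
Proof.
by move=> au; apply: cherednik_t_comm; [apply: rca_hbar_comm | apply: rca_c_comm
  | apply: wrefl_comm_y].
Qed.

Lemma comm_cherednik_t (x : H) a :
    (forall g, GRing.comm x (alg_class E (AGen C g) : H)) ->
  GRing.comm x (cherednik_t a).
Proof.
move=> x_central; apply: commrB; apply: comm_scaler; first exact: x_central.
by apply: commrM; apply: x_central.
Qed.

(** Half the sum over the whole of [Psi]: the reflection in [a] permutes [Psi],
    whereas it need not preserve the positive roots. *)
Lemma cherednik_t_subsystem Psi a : root_subsystem Phi Psi -> val a \in Psi ->
  GRing.comm (cherednik_t a)
    (\sum_(b : root | (val b \in Psi) && pos b) cherednik_t b).
Proof.
move=> Psi_sub a_Psi; set S := \sum_(b | _) _.
apply: cherednik_t_comm.
- by apply: commr_sum => b _; apply/comm_cherednik_t/rca_hbar_comm.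
- by apply: commr_sum => b _; apply/comm_cherednik_t/rca_c_comm.
have -> : S = 2^-1 *: (\sum_(b : root | val b \in Psi) cherednik_t b).
  rewrite (@sum_roots_pos _ _ _ Delta) => [|b|b]; last exact: cherednik_t_opp.
    by rewrite -/S -[S *+ 2]scaler_nat scalerA mulVf ?scale1r // pnatr_eq0.
  by rewrite root_subsystem_opp.
apply: comm_scaler; rewrite /GRing.comm mulr_sumr mulr_suml.
rewrite [RHS](sum_root_reflect (a := a)) => [|b]; last exact: root_subsystem_reflect.
apply: eq_bigr => b _; rewrite /cherednik_t mulrBr mulrBl reflection_term_reflect.
congr (_ - _); apply/comm_scaler/commr_sym/rca_hbar_comm.
Qed.

End Cherednik.

(** * The homomorphism *)

Theorem theorem6 (R : realType) (n : nat) (Phi : root_system R n)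
  (Phi_irr : irreducible_root_system Phi) (Delta : simple_system Phi)
  (theta : 'rV[R]_n) (theta_highest : highest_root Delta theta)
  (g : 'I_n -> R)
  (g_theta : coroot Phi theta = \sum_(i < n) g i *: coroot Phi (Delta i))
  (B : 'M[R[i]]_n)
  (B_sym : forall u v, bform B u v = bform B v u)
  (B_nondeg : B \in unitmx)
  (B_inv : forall (w : weyl Phi) u v,
     bform B (cplx (sval w) *m u)
            (cplx (sval w) *m v) = bform B u v)
  (B_norm : bform B (cplx (coroot Phi theta))
                   (cplx (coroot Phi theta)) = 2)
  (a b : R[i]) :
  exists f : tell Delta -> rca Delta,
    [/\ lie_hom f,
        forall v : 'cV[R[i]]_n,
          f (tell_x Delta v) = a *: rca_x Delta (bform_iso B v),
        forall u : 'cV[R[i]]_n, f (tell_y Delta u) = b *: rca_y Delta u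
      & forall c : root_set Phi, val c \in pos_roots Delta ->
          f (tell_t Delta c) =
            (a * b) *:
              ((real_complex R (1 + \sum_(i < n) g i))^-1 *: rca_hbar Delta -
               (2 / bform_dual B (cplx (val c))
                                (cplx (val c))) *:
                 (rca_c Delta (root_reflection c) *
                  rca_w Delta (reflection_weyl (root_reflection c))))].
Proof.
have B_tr : B^T = B by apply: bform_inj => u v; rewrite bform_trmx B_sym.
have B_refl : refl_invariant Phi B.
  move=> c; apply: bform_inj => u v; rewrite -bform_mul.
  exact: (B_inv (reflection_weyl (root_reflection c))).
pose t : root_set Phi := [` theta_highest.1]%fset.
pose h := 1 + \sum_(i < n) g i.
have h_neq0 : real_complex R h != 0.
  rewrite fmorph_eq0; apply/eqP => h0.
  have := root_gram_coroot_gt0 t.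
  by rewrite (@root_gram_highest_coroot _ _ _ Delta t g) // -/h h0 mul0rn ltxx.
have roots_bform u v := @sum_pos_roots_bform _ _ _ Delta B t g u v
  Phi_irr B_nondeg B_tr B_refl theta_highest g_theta B_norm.
rewrite -/h in roots_bform *.
pose phi (x : tell_gen Phi) : rca Delta := match x with
  | tgen_t c => (a * b) *: cherednik_t Delta B (real_complex R h)^-1 c
  | tgen_x v => a *: rca_x Delta (bform_iso B v)
  | tgen_y u => b *: rca_y Delta u
  end.
have phi_rel t1 t2 : tell_rel Delta t1 t2 -> lie_eval phi t1 = lie_eval phi t2.
  case=> {t1 t2}.
  - move=> c d dc /=; have -> : d = root_opp c.
      by apply: val_inj; rewrite val_root_opp.
    by rewrite cherednik_t_opp.
  - move=> k u v /=.
    have -> : bform_iso B (k *: u + v) = k *: bform_iso B u + bform_iso B v.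
      by rewrite /bform_iso linearP /= mulmxDl -scalemxAl.
    by rewrite rca_x_linear scalerDr !scalerA mulrC.
  - by move=> k u v /=; rewrite rca_y_linear scalerDr !scalerA mulrC.
  - move=> Psi c Psi_sub _ c_Psi; rewrite [LHS]/= lie_eval_sum /= -scaler_sumr.
    rewrite rca_bracketZ rca_bracket_comm ?scaler0 //.
    exact: cherednik_t_subsystem.
  - by move=> u v /=; rewrite rca_bracketZ rca_bracket_x scaler0.
  - by move=> u v /=; rewrite rca_bracketZ rca_bracket_y scaler0.
  (* [[y u, x v]]: the sum over positive roots splits into its [hbar] part, which
     is [h (u | v) / h], and its reflection part, which agrees term by term. *)
  - move=> u v; rewrite lie_eval_sum /= rca_bracketZ rca_bracket_yx [b * a]mulrC.
    under [RHS]eq_bigr => c _ do rewrite scalerA mulrC -scalerA.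
    rewrite -scaler_sumr; congr (_ *: _).
    under [RHS]eq_bigr => c _ do rewrite scalerBr scalerA.
    rewrite sumrB -scaler_suml -mulr_suml roots_bform mulrAC divff // mul1r.
    congr (_ - _); apply: eq_bigr => c _; rewrite /reflection_term scalerA.
    congr (_ *: _); rewrite bform_dual_root // -bformE -[in LHS]B_tr bform_trmx.
    apply: (mulIf (_ : 2 != 0 :> R[i])); first by rewrite pnatr_eq0.
    rewrite mulrA divfK ?pnatr_eq0 //.
    rewrite -mulrA [_ * 2]mulrC refl_invariant_bform // mulrCA [RHS]mulrC.
    by congr (_ * _); rewrite mulrC.
  - move=> c u cu /=; rewrite rca_bracketZ rca_bracket_comm ?scaler0 //.
    exact: cherednik_t_comm_x.
  - move=> c u cu /=; rewrite rca_bracketZ rca_bracket_comm ?scaler0 //.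
    exact: cherednik_t_comm_y.
have lift_class := lie_lift_class phi_rel.
exists (lie_lift (E := tell_rel Delta) phi); split.
- exact: lie_lift_hom.
- by move=> v; apply: lift_class.
- by move=> u; apply: lift_class.
- by move=> c _; apply: lift_class.
Qed.
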